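(* Let $S$ be a nonempty closed convex subset of a Banach space $E$ and let $T : S\to \mathcal{P}(S)$ be a multi-valued mapping with a weakly sequentially closed graph such that: (i) there exists a bounded set $\Omega$ belonging to the family $\{S^T_n : n\in\mathbb{N}\}$; (ii) $T$ is hemi-weakly compact on $\Omega$ and has closed, convex values on $\Omega$; (iii) $T$ is countably $\mathcal{D}$-set-Lipschitzian on $\Omega$ with $\mathcal{D}$-function $\varphi$. If $\varphi(r)\le r$ for all $0<r\le \|\Omega\|$, then $T$ has at least one fixed point in $\Omega$, i.e. there is $x\in\Omega$ with $x\in T(x)$.
   Context: $\mathcal{P}(S)$ is the family of all nonempty subsets of $S$. For $M\subset S$, $T(M)=\bigcup_{x\in M}T(x)$. For a set $\Omega\subset E$, $\|\Omega\|=\sup\{\|x\|: x\in\Omega\}$. $\rightharpoonup$ denotes weak convergence. $\mathbb N$ includes $0$. The sequence $(S^T_n)$ is defined by $S^T_0=S$ and $S^T_{n+1}=\overline{co}(T(S^T_n))$, $n=0,1,\dots$, where $\overline{co}$ is the closed convex hull. $T$ has a weakly sequentially closed graph if whenever $x_n\in S$, $x_n\rightharpoonup x\in S$, $y_n\in T(x_n)$ and $y_n\rightharpoonup y$ in $E$, then $y\in T(x)$. $T$ is hemi-weakly compact on $\Omega$ if, for every sequence $(x_n)$ in $\Omega$ and every choice $y_n\in T(x_n)$ such that $(x_n-y_n)$ converges weakly, $(x_n)$ has a weakly convergent subsequence. $\beta$ is the De Blasi measure of weak noncompactness: for bounded $W\subset E$, $\beta(W)=\inf\{\varepsilon>0:\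 \exists K\subset E \text{ weakly compact},\ W\subset K+\mathcal{B}_E(\varepsilon)\}$, where $\mathcal{B}_E(\varepsilon)$ is the closed ball of radius $\varepsilon$ centred at the origin. $T$ is countably $\mathcal{D}$-set-Lipschitzian on $\Omega$ with $\mathcal{D}$-function $\varphi$ if $\varphi:\mathbb{R}_+\to\mathbb{R}_+$ is continuous, nondecreasing, $\varphi(0)=0$, and $\beta(T(W))\le\varphi(\beta(W))$ for every countable bounded subset $W$ of $\Omega$ with $T(W)$ bounded. *)

(* Defs.v *)
From HB Require Import structures.
From mathcomp Require Import all_boot all_order all_algebra.
From mathcomp Require Import all_classical all_reals all_analysis.

Set Implicit Arguments.
Unset Strict Implicit.
Unset Printing Implicit Defensive.

Import Order.TTheory GRing.Theory Num.Theory.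
Import numFieldNormedType.Exports.

Local Open Scope classical_set_scope.
Local Open Scope ring_scope.

Definition topological_dual (R : realType) (E : normedModType R) :=
  {f : {linear E -> R^o} | continuous f}.

(* [weak E] is the carrier of [E] with the coarsest topology making every
   element of the topological dual continuous. *)
Definition weak (R : realType) (E : normedModType R) : topologicalType :=
  sup_topology (fun f : topological_dual E =>
    Topological.class (initial_topology (sval f : E -> R^o))).

Definition weak_cvg (R : realType) (E : normedModType R) (u : nat -> E)
    (l : E) : Prop :=
  (u : nat -> weak E) n @[n --> \oo] --> (l : weak E).

Definition weakly_compact (R : realType) (E : normedModType R) (K : set E) :
    Prop :=
  compact (K : set (weak E)).

Definition closed_convex_hull (R : realType) (E : normedModType R)
    (A : set E) : set E :=
  smallest (fun C : set E => closed C /\ convex_set C) A.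

(* A multi-valued map T : S -> P(S) is a function [E -> set E], of which only
   the values at points of [S] matter. *)
Definition multimap_on (E : Type) (S : set E) (T : E -> set E) : Prop :=
  forall x, S x -> T x !=set0 /\ T x `<=` S.

Definition mimage (E : Type) (T : E -> set E) (M : set E) : set E :=
  \bigcup_(x in M) T x.

Fixpoint hull_iter (R : realType) (E : normedModType R) (S : set E)
    (T : E -> set E) (n : nat) : set E :=
  if n is m.+1 then closed_convex_hull (mimage T (hull_iter S T m)) else S.

Definition set_norm (R : realType) (E : normedModType R) (A : set E) : R :=
  sup [set `|x| | x in A].

Definition weakly_seq_closed_graph (R : realType) (E : normedModType R)
    (S : set E) (T : E -> set E) : Prop :=
  forall (x_ y_ : nat -> E) (x y : E),
    (forall n, S (x_ n)) -> S x -> weak_cvg x_ x ->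
    (forall n, T (x_ n) (y_ n)) -> weak_cvg y_ y ->
    T x y.

Definition hemi_weakly_compact (R : realType) (E : normedModType R)
    (Omega : set E) (T : E -> set E) : Prop :=
  forall x_ y_ : nat -> E,
    (forall n, Omega (x_ n)) -> (forall n, T (x_ n) (y_ n)) ->
    (exists z, weak_cvg (fun n => x_ n - y_ n) z) ->
    exists2 k : nat -> nat, {homo k : m n / (m < n)%N} &
      exists x, weak_cvg (x_ \o k) x.

(* De Blasi's measure of weak noncompactness. The infimum is taken in [R]; it
   is meaningful for bounded [W], and is 0 by convention when no [e] works. *)
Definition de_blasi (R : realType) (E : normedModType R) (W : set E) : R :=
  inf [set e : R | 0 < e /\
    exists2 K : set E, weakly_compact K &
      W `<=` [set k + b | k in K & b in closed_ball (0 : E) e]].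

(* D-functions map the half-line [0, +oo[ to itself: the values of [phi] at
   negative reals are irrelevant. *)
Definition D_function (R : realType) (phi : R -> R) : Prop :=
  [/\ forall r, 0 <= r -> 0 <= phi r,
      {within `[0, +oo[, continuous phi},
      {in `[0, +oo[ &, {homo phi : r s / r <= s}} &
      phi 0 = 0].

Definition countably_D_set_Lipschitzian (R : realType) (E : normedModType R)
    (Omega : set E) (T : E -> set E) (phi : R -> R) : Prop :=
  D_function phi /\
  forall W : set E, countable W -> W `<=` Omega -> bounded_set W ->
    bounded_set (mimage T W) ->
    de_blasi (mimage T W) <= phi (de_blasi W).

(* Main.v *)
(* The contractions [x |-> lam T x + (1 - lam) x0], with [x0] in [Omega] and
   [lam < 1], have fixed points, and letting [lam] tend to 1 yields [x_n] and
   [y_n] in [T x_n] with [x_n - y_n] tending to 0 in norm; hemi-weak compactness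
   and the closed graph conclude.

   For a contraction, fix a selection and let [D] be the smallest set containing
   [x0] and stable by the selection and by midpoints.  It is countable and lies
   in the convex hull of [x0] and its image, so [beta D <= lam * beta D] (the
   convex hull costs nothing by the Krein-Smulian theorem) and [beta D = 0].  By
   Grothendieck's criterion the closure [X] of [D] is weakly compact; being
   separable, it is weakly sequentially compact without Eberlein-Smulian.  The
   countable-set hypothesis thus suffices, and Kakutani's argument (Schauder
   projection on finite nets of [D], then Brouwer) applies in [X].  The
   contraction need not map [X] into [X]: only its selection on [D] is used.

   Brouwer's theorem is derived from Scarf's combinatorial lemma, and the
   Krein-Smulian theorem from Simons' inequality. *)

(* The hypothesis only says [phi r <= r], so [T] itself need not lower [beta]; the factor [lam]
   supplies the strict inequality. Midpoints make the closure of [D] convex while [D] stays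
   countable, and stability under the selection keeps in that closure every value that a Schauder
   projection averages. The graph is closed only along weakly convergent sequences of actual values
   of [T], whereas a Schauder projection controls finitely many functionals and produces averages of
   values. The order of quantifiers in [schauder_step] bridges this gap: the approximate fixed point
   is fixed first, and then each functional [f] gets its own point [d n], with a genuine selected
   value on the right side of [f]. If the limit [x] were outside the closed convex set of values at
   [x], an [f] separating the two would contradict the limit of the values extracted for that [f].
   Separability serves a second time in the Krein-Smulian theorem: smallness on the first points of
   a dense sequence is a finite system of conditions, which Helly's lemma can meet, and it forces
   pointwise convergence to 0, which Simons' inequality forbids. *)
Require Import Defs.
From HB Require Import structures.
From mathcomp Require Import all_boot.

Set Implicit Arguments.
Unset Strict Implicit.
Unset Printing Implicit Defensive.

(** * Scarf's lemma *)

Section Scarf.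
Variables (I Y : finType) (r : I -> Y -> nat) (e : I -> Y) (c : Y -> I).
Hypothesis r_inj : forall i, injective (r i).
Hypothesis e_min : forall i y, r i (e i) <= r i y.
Hypothesis e_max : forall i j y, j != i -> (forall k, y != e k) ->
  r i y < r i (e j).
Hypothesis eK : cancel e c.

(** Scarf's dominating sets: no point exceeds the minimum of [Z] in all rankings at once. Tested on
    the points of a nonempty [Z], it makes each of them the minimizer for some index, so that [Z]
    has at most [#|I|] points. *)
Definition dominant (Z : {set Y}) :=
  [forall y, exists i, forall z in Z, r i y <= r i z].

Lemma dominantP (Z : {set Y}) :
  reflect (forall y, exists i, forall z, z \in Z -> r i y <= r i z) (dominant Z).
Proof.
apply: (iffP forallP) => h y.
  by have /existsP[i /forall_inP ?] := h y; exists i.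
by have [i ?] := h y; apply/existsP; exists i; apply/forall_inP.
Qed.

Lemma dominantS (Z Z' : {set Y}) : Z \subset Z' -> dominant Z' -> dominant Z.
Proof.
move=> /subsetP ZZ' /dominantP h; apply/dominantP => y.
by have [i hi] := h y; exists i => z /ZZ'; exact: hi.
Qed.

Definition minimizer (z0 : Y) (Z : {set Y}) i := [arg min_(z < z0 in Z) r i z].

Section Minimizer.
Variables (z0 : Y) (Z : {set Y}).
Hypothesis z0Z : z0 \in Z.
Local Notation m := (minimizer z0 Z).

Lemma minimizer_in i : m i \in Z.
Proof. by rewrite /minimizer; case: arg_minnP. Qed.

Lemma minimizer_le i z : z \in Z -> r i (m i) <= r i z.
Proof. by rewrite /minimizer; case: arg_minnP => // ? _; exact. Qed.

Lemma minimizer_unique i y : y \in Z -> (forall z, z \in Z -> r i y <= r i z) ->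
  m i = y.
Proof.
move=> yZ hy; apply: (@r_inj i); apply/eqP.
by rewrite eqn_leq minimizer_le// hy// minimizer_in.
Qed.

Lemma dominant_minimizer z : dominant Z -> z \in Z -> exists i, m i = z.
Proof.
by move=> /dominantP/(_ z)[i hi] zZ; exists i; exact: minimizer_unique.
Qed.

Lemma imset_minimizer : dominant Z -> m @: [set: I] = Z.
Proof.
move=> dZ; apply/setP => z; apply/imsetP/idP => [[i _ ->]|zZ].
  exact: minimizer_in.
by have [i <-] := dominant_minimizer dZ zZ; exists i.
Qed.

Lemma minimizer_inj : dominant Z -> #|Z| = #|I| -> injective m.
Proof.
move=> dZ cZ i j; have /imset_injP : #|m @: [set: I]| == #|[set: I]|.
  by rewrite imset_minimizer// cardsT cZ.
by apply; rewrite inE.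
Qed.

(** The minimizer maps [I] onto [Z] with one index to spare. Dropping any colliding index leaves a
    surjection between sets of equal size, hence an injection, so all collisions involve the same
    two indices. *)
Lemma minimizer_collision : dominant Z -> #|Z|.+1 = #|I| ->
  exists i j, [/\ i != j, m i = m j & forall k l, k != l -> m k = m l ->
    k \in [set i; j]].
Proof.
move=> dZ cZ.
have [|ninj] := boolP (injectiveb m).
  move=> /injectiveP/(@card_imset _ _ _ [set: I]).
  by rewrite imset_minimizer// cardsT -cZ => /n_Sn.
have : exists i j, i != j /\ m i = m j.
  have /injectivePn[i [j ij mij]] := ninj.
  by exists i, j.
move=> [i [j [ij mij]]]; exists i, j; split => // k l kl mkl.
have inj1 a b : a != b -> m a = m b -> {in [set~ a] &, injective m}.
  move=> ab mab; apply/imset_injP.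
  have -> : m @: [set~ a] = Z.
    rewrite -[RHS]imset_minimizer//; apply/setP => z; apply/imsetP/imsetP.
      by move=> [u _ ->]; exists u.
    move=> [u _ ->]; have [->|ua] := eqVneq u a.
      by exists b => //; rewrite !inE eq_sym.
    by exists u; rewrite ?inE.
  by rewrite cardsC1 -cZ.
rewrite !inE; apply/negPn/negP; rewrite negb_or => /andP[ki kj].
have := inj1 k l kl mkl i j; rewrite !inE eq_sym ki eq_sym kj => /(_ isT isT mij).
by move/eqP; apply/negP.
Qed.

End Minimizer.

(* The points that can be added to the door [Z] in exchange for the role of
   the index [k]. *)
Definition beyond (Z : {set Y}) k :=
  [set y | [forall l, (l != k) ==> [exists z in Z, r l z < r l y]]].

Lemma beyondP (Z : {set Y}) k y :
  reflect (forall l, l != k -> exists2 z, z \in Z & r l z < r l y)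
    (y \in beyond Z k).
Proof.
rewrite inE; apply: (iffP forallP) => h l.
  move=> lk; have := h l; rewrite lk => /exists_inP[z zZ rz].
  by exists z.
by apply/implyP => /h[z zZ rz]; apply/exists_inP; exists z.
Qed.

(** Maximality keeps the enlarged set dominant: the points of [beyond Z k], which escape the other
    indices, are then caught by [k]. Injectivity of [r k] leaves at most one candidate. *)
Definition extreme (Z : {set Y}) k :=
  [set z in beyond Z k | [forall y in beyond Z k, r k y <= r k z]].

Lemma card_extreme Z k : #|extreme Z k| = (beyond Z k != set0).
Proof.
have [b0|] := eqVneq (beyond Z k) set0.
  apply/eqP; rewrite cards_eq0; apply/eqP/setP => z.
  by rewrite inE b0 !inE.
move=> /set0Pn[y0 hy0].
apply/eqP/cards1P; exists [arg max_(y > y0 in beyond Z k) r k y].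
case: arg_maxnP => // z hz zmax; apply/setP => y; rewrite in_set1 inE.
apply/andP/eqP => [[hy /forall_inP ymax]|->].
  by apply: (@r_inj k); apply/eqP; rewrite eqn_leq ymax// andbT; exact: zmax.
by split => //; apply/forall_inP.
Qed.

Section Pivot.
Variables (Z : {set Y}) (z0 : Y) (i j : I).
Hypothesis z0Z : z0 \in Z.
Local Notation m := (minimizer z0 Z).
Hypothesis Zdom : dominant Z.
Hypothesis cZ : #|Z|.+1 = #|I|.
Hypothesis ij : i != j.
Hypothesis mij : m i = m j.
Hypothesis collision : forall k l, k != l -> m k = m l -> k \in [set i; j].

Lemma beyond_notin k z : k \in [set i; j] -> z \in beyond Z k -> z \notin Z.
Proof.
move=> kij /beyondP zk; apply/negP => zZ.
have [l mlz] := dominant_minimizer z0Z Zdom zZ.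
suff [l' lk ml'z] : exists2 l', l' != k & m l' = z.
  have [w wZ] := zk _ lk.
  by rewrite -ml'z ltnNge minimizer_le.
have [lk|] := eqVneq l k; last by exists l.
move: kij; rewrite !inE => /orP[] /eqP kE.
  by exists j; [rewrite kE eq_sym|rewrite -mij -mlz lk kE].
by exists i; [rewrite kE|rewrite mij -mlz lk kE].
Qed.

Lemma dominant_extreme k z : k \in [set i; j] -> z \in extreme Z k ->
  dominant (z |: Z).
Proof.
move=> kij; rewrite !inE => /andP[zk /forall_inP zmax].
have {}zk : z \in beyond Z k by rewrite inE.
apply/dominantP => y; have [yk|yk] := boolP (y \in beyond Z k).
  exists k => w; rewrite !inE => /orP[/eqP ->|wZ].
    exact: zmax.
  move/dominantP: Zdom => /(_ y)[l hl].
  have [<-|lk] := eqVneq l k; first exact: hl.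
  move/beyondP: yk => /(_ _ lk)[w' w'Z].
  by rewrite ltnNge hl.
move: yk; rewrite inE negb_forall => /existsP[l].
rewrite negb_imply => /andP[lk]; rewrite negb_exists_in => /forall_inP hl.
exists l => w; rewrite !inE => /orP[/eqP ->|wZ]; last first.
  by rewrite leqNgt hl.
move/beyondP: zk => /(_ _ lk)[w' w'Z /ltnW]; apply: leq_trans.
by rewrite leqNgt hl.
Qed.

(** In the room [z |: Z] the minimizer is a bijection. Only the index [k] served by [z] has changed
    hands, and [k] must be [i] or [j] since otherwise these two would still collide. *)
Lemma extreme_dominant z : z \notin Z -> dominant (z |: Z) ->
  exists2 k, k \in [set i; j] & z \in extreme Z k.
Proof.
move=> zZ dq; set q := z |: Z.
have z0q : z0 \in q by rewrite !inE z0Z orbT.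
have zq : z \in q by rewrite !inE eqxx.
have cq : #|q| = #|I| by rewrite cardsU1 zZ.
have injq := minimizer_inj z0q dq cq.
have [k mk] := dominant_minimizer z0q dq zq.
have ml l : l != k -> minimizer z0 q l = m l.
  move=> lk; have /setU1P[h|h] := minimizer_in z0q l.
    by move: lk; rewrite (injq l k) ?eqxx// mk.
  apply/esym/minimizer_unique => // w wZ.
  by apply: minimizer_le => //; rewrite !inE wZ orbT.
have zk : z \in beyond Z k.
  apply/beyondP => l lk; exists (m l); first exact: minimizer_in.
  rewrite -ml// ltn_neqAle minimizer_le// andbT.
  apply: contra lk => /eqP/r_inj; rewrite -mk => /injq ->.
  by rewrite eqxx.
exists k.
  apply/negPn/negP => kij; move: (kij); rewrite !inE negb_or => /andP[ki kj].
  have := mij; rewrite -!ml 1?eq_sym// => /injq/eqP.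
  by rewrite (negPf ij).
rewrite inE zk; apply/forall_inP => y /beyondP hy.
move/dominantP: dq => /(_ y)[l hl].
have [<-|lk] := eqVneq l k; first by apply: hl.
have [w wZ] := hy _ lk.
by rewrite ltnNge hl// !inE wZ orbT.
Qed.

Lemma card_rooms_above :
  #|[set q : {set Y} | [&& Z \subset q, #|q| == #|I| & dominant q]]| =
  (beyond Z i != set0) + (beyond Z j != set0).
Proof.
rewrite -!card_extreme.
have dis : [disjoint extreme Z i & extreme Z j].
  apply/pred0P => z /=; rewrite !inE; apply/negbTE/negP.
  move=> /andP[/andP[zi _] /andP[zj _]].
  have {}zi : z \in beyond Z i by rewrite inE.
  have {}zj : z \in beyond Z j by rewrite inE.
  move/dominantP: Zdom => /(_ z)[l hl].
  have [lE|li] := eqVneq l i.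
    move/beyondP: zj => /(_ l); rewrite lE ij => /(_ isT)[w wZ].
    by rewrite ltnNge -lE hl.
  move/beyondP: zi => /(_ l li)[w wZ].
  by rewrite ltnNge hl.
rewrite -cardsUI; have /eqP -> : extreme Z i :&: extreme Z j == set0.
  by rewrite setI_eq0.
rewrite cards0 addn0.
have extr_notin z : z \in extreme Z i :|: extreme Z j -> z \notin Z.
  by move=> /setUP[]; rewrite inE => /andP[h _];
    apply: (beyond_notin _ h); rewrite !inE eqxx ?orbT.
rewrite -(card_in_imset (f := fun z => z |: Z)); last first.
  move=> a b /extr_notin aZ /extr_notin bZ /setP/(_ a).
  by rewrite !inE eqxx (negPf aZ) !orbF => /esym/eqP.
apply: eq_card => q; rewrite inE; apply/and3P/imsetP.
  move=> [Zq cq dq].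
  have : #|q :\: Z| == 1 by rewrite cardsDS// (eqP cq) -cZ subSnn.
  move=> /cards1P[z qZ].
  have qE : q = z |: Z.
    rewrite -qZ; apply/setP => w; rewrite !inE.
    by case: (boolP (w \in Z)) => [/(subsetP Zq) ->|]; rewrite ?orbT ?orbF.
  have zZ : z \notin Z.
    by have : z \in q :\: Z by [rewrite qZ set11]; rewrite in_setD => /andP[].
  exists z => //; rewrite qE in dq.
  have [k] := extreme_dominant zZ dq.
  by rewrite !in_setU => /orP[] /set1P -> ->; rewrite ?orbT.
move=> [z hz ->]; split.
- exact: subsetUr.
- by rewrite cardsU1 extr_notin// -cZ.
- by move: hz => /setUP[] h; apply: (dominant_extreme _ h); rewrite !inE eqxx ?orbT.
Qed.

End Pivot.

Definition door i0 (p : {set Y}) :=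
  [&& dominant p, c @: p == [set~ i0] & #|p|.+1 == #|I|].

Definition room (q : {set Y}) := dominant q && (#|q| == #|I|).

Lemma odd_rooms_above i0 i1 p : i1 != i0 -> door i0 p ->
  odd #|[set q : {set Y} | (p \subset q) && room q]| = (p == e @: [set~ i0]).
Proof.
move=> i10 /and3P[dp cp /eqP np].
have [z0 z0p] : exists z0, z0 \in p.
  apply/set0Pn; apply/eqP => p0; move: cp; rewrite p0 imset0 => /eqP/setP/(_ i1).
  by rewrite !inE i10.
have [i [j [ij mij col]]] := minimizer_collision z0p dp np.
have -> : [set q : {set Y} | (p \subset q) && room q] =
   [set q : {set Y} | [&& p \subset q, #|q| == #|I| & dominant q]].
  by apply/setP => q; rewrite !inE /room [dominant q && _]andbC.
rewrite (card_rooms_above z0p dp np ij mij).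
have [pE|pE] := eqVneq p (e @: [set~ i0]); last first.
  (* The colours of [p] omit [i0], so a door other than the slack one contains a non-slack [w]. Then
     [w] ranks below [e k] for every index but [k], which puts [e k] in [beyond p k]: both exchanges
     are possible. *)
  suff nonslack k : beyond p k != set0 by rewrite !nonslack.
  have [w wp wE] : exists2 w, w \in p & forall k, w != e k.
    have : ~~ (p \subset e @: [set~ i0]).
      apply: contra pE => sub; rewrite eqEcard sub card_imset; last exact: can_inj eK.
      by rewrite cardsC1 -np /= leqnn.
    move=> /subsetPn[w wp wE]; exists w => {k} // k; apply: contra wE => /eqP wE.
    rewrite wE imset_f// -(eqP cp) -(eK k) -wE.
    exact: imset_f.
  apply/set0Pn; exists (e k); apply/beyondP => l lk; exists w => //.
  by apply: e_max => //; rewrite eq_sym.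
have mE l : l != i0 -> minimizer z0 p l = e l.
  move=> li0; apply: minimizer_unique => //.
  by rewrite pE imset_f// !inE.
have b0 : beyond p i0 != set0.
  apply/set0Pn; exists (e i0); apply/beyondP => l li0; exists (e l).
    by rewrite pE imset_f// !inE.
  rewrite ltn_neqAle e_min andbT; apply: contra li0 => /eqP/r_inj.
  by move=> /(can_inj eK) ->.
(* A point of [beyond p k] exceeds a slack point for [i0], hence is slack itself; it is then either
   the minimum of [p] for [i0] or the bottom of its own ranking, and both are absurd. *)
have bk k : k != i0 -> minimizer z0 p k = minimizer z0 p i0 -> beyond p k = set0.
  move=> ki0 mk; apply/setP => y; rewrite in_set0; apply/negbTE/negP => /beyondP hy.
  have [|w wp wy] := hy i0; first by rewrite eq_sym.
  have [l /eqP yE] : exists l, y == e l.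
    apply/existsP; apply: contraLR wy; rewrite negb_exists -leqNgt => /forallP ny.
    move: wp; rewrite pE => /imsetP[l]; rewrite !inE => li0 ->.
    by rewrite ltnW// e_max.
  have [lE|lk] := eqVneq l k.
    move: wy; rewrite yE lE -mE// mk ltnNge minimizer_le//.
  by have [w' _] := hy l lk; rewrite yE ltnNge e_min.
have : (i == i0) || (j == i0).
  apply/negPn/negP; rewrite negb_or => /andP[ii0 ji0].
  move: mij; rewrite !mE// => /(can_inj eK)/eqP.
  by rewrite (negPf ij).
move=> /orP[] /eqP k0; move: ij mij; rewrite k0 => i0k mk.
  by rewrite b0 (bk j)// 1?eq_sym// eqxx.
by rewrite b0 (bk i)// eqxx.
Qed.

(** If all colours occur, each occurs once and the only door omits the point of colour [i0].
    Otherwise a door [q :\ z] has a unique point [z'] of the colour of [z], and exchanging [z] and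
    [z'] gives exactly one other door. *)
Lemma odd_doors_below i0 q : room q ->
  odd #|[set p : {set Y} | (p \subset q) && door i0 p]| = (c @: q == [set: I]).
Proof.
move=> /andP[dq /eqP nq].
have [cq|cq] := eqVneq (c @: q) [set: I].
  have inj : {in q &, injective c}.
    by apply/imset_injP; rewrite cq cardsT nq.
  have : i0 \in c @: q by rewrite cq inE.
  move=> /imsetP[x xq cx].
  rewrite (_ : [set p : {set Y} | _] = [set q :\ x]) ?cards1//.
  have cqx y : y \in q -> c @: (q :\ y) = [set~ c y].
    move=> yq; apply/setP => k; rewrite !inE; apply/imsetP/idP.
      move=> [w]; rewrite !inE => /andP[wy wq] ->.
      by apply: contra wy => /eqP/inj ->.
    have : k \in c @: q by rewrite cq inE.
    move=> /imsetP[w wq ->] wy; exists w => //; rewrite !inE wq andbT.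
    by apply: contra wy => /eqP ->.
  apply/setP => p; rewrite !inE; apply/andP/eqP => [[pq]|->]; last first.
    split; first exact: subsetDl.
    rewrite /door (dominantS _ dq) ?subsetDl// cqx// -cx eqxx/=.
    by rewrite -nq (cardsD1 x q) xq.
  move=> /and3P[_ /eqP cp /eqP np].
  apply/eqP; rewrite eqEcard subsetD1 pq/=; apply/andP; split.
    apply/negP => xp; have := imset_f c xp; rewrite cp -cx !inE eqxx//.
  by have := cardsD1 x q; rewrite xq nq -np add1n => -[<-].
have [->|/set0Pn[p]] := eqVneq [set p : {set Y} | (p \subset q) && door i0 p] set0.
  by rewrite cards0.
rewrite inE => /andP[pq /and3P[_ /eqP cp /eqP np]].
have : #|q :\: p| == 1 by rewrite cardsDS// nq -np subSnn.
move=> /cards1P[z qp].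
have zp : z \notin p.
  by have : z \in q :\: p by [rewrite qp set11]; rewrite in_setD => /andP[].
have qE : q = z |: p.
  rewrite -qp; apply/setP => w; rewrite !inE.
  by case: (boolP (w \in p)) => [/(subsetP pq) ->|]; rewrite ?orbT ?orbF.
have : c z \in c @: p.
  rewrite cp !inE; apply: contra cq => /eqP cz.
  by rewrite qE imsetU1 cp cz setUCr.
move=> /imsetP[z' z'p cz].
have injp : {in p &, injective c}.
  by apply/imset_injP; rewrite cp cardsC1 -np.
have cq' : c @: q = [set~ i0].
  by rewrite qE imsetU1 cp; apply/setUidPr; rewrite sub1set -cp cz imset_f.
have zq : z \in q by rewrite qE !inE eqxx.
have z'q : z' \in q by rewrite qE !inE z'p orbT.
have zz' : z != z' by apply: contra zp => /eqP ->.
rewrite (_ : [set p : {set Y} | _] = [set q :\ z; q :\ z']).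
  rewrite cards2 (_ : _ != _) //; apply/eqP => /setP/(_ z').
  by rewrite !inE eqxx eq_sym zz' z'q.
apply/setP => p'; rewrite !inE; apply/andP/orP.
  move=> [p'q /and3P[_ /eqP cp' /eqP np']].
  have : #|q :\: p'| == 1 by rewrite cardsDS// nq -np' subSnn.
  move=> /cards1P[w qp'].
  have p'E : p' = q :\ w.
    by rewrite -qp' setDDr setDv set0U; apply/esym/setIidPr.
  have wq : w \in q.
    by have : w \in q :\: p' by [rewrite qp' set11]; rewrite in_setD => /andP[].
  suff : (w == z) || (w == z').
    by rewrite p'E => /orP[] /eqP ->; [left|right].
  apply/negPn/negP; rewrite negb_or => /andP[wz wz'].
  have wp : w \in p by move: wq; rewrite qE !inE (negPf wz).
  have : c w \in c @: p' by rewrite cp' -cp imset_f.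
  rewrite p'E => /imsetP[v]; rewrite qE !inE => /andP[vw /orP[/eqP ->|vp]] cwv.
    by move: wz'; rewrite (injp w z') ?eqxx// cwv.
  by move: vw; rewrite (injp w v) ?eqxx.
have doorD1 y y' : y \in q -> y' \in q -> y != y' -> c y = c y' ->
    q :\ y \subset q /\ door i0 (q :\ y).
  move=> yq y'q yy' cyy'; split; first exact: subsetDl.
  rewrite /door (dominantS _ dq) ?subsetDl//=; apply/andP; split; last first.
    by rewrite -nq (cardsD1 y q) yq.
  rewrite -cq'; apply/eqP/setP => k; apply/imsetP/imsetP => [[w]|[w wq ->]].
    by rewrite !inE => /andP[_ wq ->]; exists w.
  have [->|wy] := eqVneq w y; first by exists y'; rewrite // !inE eq_sym yy'.
  by exists w => //; rewrite !inE wy.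
by case=> /eqP ->; [exact: (@doorD1 z z')|apply: (@doorD1 z' z); rewrite // eq_sym].
Qed.

Lemma odd_sum (J : finType) (A : {pred J}) (F : J -> nat) :
  odd (\sum_(j in A) F j) = \big[addb/false]_(j in A) odd (F j).
Proof. exact: (big_morph odd oddD). Qed.

(* Every door lies in two rooms except the one made of slack points, which lies
   in one, while every room has an even number of doors unless it sees all
   colours: double counting the incidences modulo 2. *)
Lemma colorful_room (i0 i1 : I) : i1 != i0 ->
  exists2 q, dominant q & c @: q = [set: I].
Proof.
move=> i10; set p0 := e @: [set~ i0].
have d0 : door i0 p0.
  rewrite /door card_imset; last exact: can_inj eK.
  rewrite cardsC1 (cardD1 i0) inE/= eqxx andbT.
  apply/andP; split; last first.
    by rewrite -imset_comp (eq_imset _ eK) imset_id.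
  apply/dominantP => y; have [/existsP[l /eqP ->]|] := boolP [exists l, y == e l].
    by exists l => z _; exact: e_min.
  rewrite negb_exists => /forallP ny; exists i0 => _ /imsetP[l + ->].
  by rewrite !inE => li0; rewrite ltnW// e_max.
have odd1 : odd (\sum_(p | door i0 p) #|[set q : {set Y} | (p \subset q) && room q]|).
  rewrite odd_sum (bigD1 p0)//= (odd_rooms_above i10)// eqxx big1//= => p.
  by move=> /andP[dp pp0]; rewrite (odd_rooms_above i10)//; exact/negbTE.
have dcount : \sum_(p | door i0 p) #|[set q : {set Y} | (p \subset q) && room q]| =
    \sum_(q | room q) #|[set p : {set Y} | (p \subset q) && door i0 p]|.
  transitivity (\sum_(p | door i0 p) \sum_(q | room q && (p \subset q)) 1).
    by apply: eq_bigr => p _; rewrite sum1dep_card; apply: eq_card => q;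
      rewrite !inE andbC.
  rewrite (exchange_big_dep room)/=; last by move=> p q _ /andP[].
  apply: eq_bigr => q rq; rewrite sum1dep_card; apply: eq_card => p.
  by rewrite !inE rq andbC.
have [/existsP[q /andP[/andP[dq _] /eqP cq]]|] :=
  boolP [exists q, room q && (c @: q == [set: I])]; first by exists q.
rewrite negb_exists => /forallP nq; move: odd1.
rewrite dcount odd_sum big1// => q rq; rewrite odd_doors_below//.
  by apply/negbTE; apply: contra (nq q) => ->; rewrite andbT.
Qed.

End Scarf.

(* One slack point per colour is added to [X]; [C] collects the colours whose
   slack point is not used. *)
Lemma scarf (I X : finType) (x0 : X) (i0 i1 : I) (rk : I -> X -> nat)
    (c : X -> I) : i1 != i0 -> (forall i, injective (rk i)) ->
  exists (s : {set X}) (C : {set I}), [/\ s != set0, C \subset c @: s &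
    forall y, exists2 i, i \in C & forall x, x \in s -> rk i y <= rk i x].
Proof.
move=> i10 rk_inj.
pose big i := \max_(x : X) (rk i x).+2.
(* The slack point of [i] is the bottom of ranking [i], for which [.+1] frees the value 0, and lies
   above all of [X] in the other rankings; [enum_rank] only separates slack points. *)
pose r i (y : X + I) := match y with
  | inl x => (rk i x).+1 | inr j => if j == i then 0 else big i + enum_rank j end.
pose c' (y : X + I) := match y with inl x => c x | inr j => j end.
have rbig i x : (rk i x).+1 < big i by exact: (@leq_bigmax _ (fun x => (rk i x).+2)).
have [||||q /dominantP dq cq] := @colorful_room I (X + I)%type r inr c' _ _ _ _ i0 i1 i10.
- move=> i [x|j] [x'|j'] /=.
  + by move=> [] /rk_inj ->.
  + case: ifP => // _ h; have := rbig i x; rewrite h ltnNge leq_addr//.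
  + case: ifP => // _ h; have := rbig i x'; rewrite -h ltnNge leq_addr//.
  + have bp j2 : big i + j2 != 0.
      by rewrite -lt0n ltn_addr// (leq_ltn_trans _ (rbig i x0)).
    case: ifP => [/eqP ->|_]; case: ifP => [/eqP ->|_] //.
    * by move=> /esym/eqP; rewrite (negbTE (bp _)).
    * by move=> /eqP; rewrite (negbTE (bp _)).
    * by move=> /addnI /val_inj/enum_rank_inj ->.
- by move=> i y /=; rewrite eqxx.
- move=> i j [x|k] ji ny /=; last by have := ny k; rewrite eqxx.
  by rewrite (negbTE ji) ltn_addr// (ltn_trans (ltnSn _)).
- by [].
have dom y : exists2 i, inr i \notin q & forall x, inl x \in q -> rk i y <= rk i x.
  have [i hi] := dq (inl y); exists i.
    by apply/negP => /hi /=; rewrite eqxx.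
  by move=> x /hi.
have sub : [set i | inr i \notin q] \subset c @: [set x | inl x \in q].
  apply/subsetP => i; rewrite inE => iq.
  have : i \in c' @: q by rewrite cq inE.
  move=> /imsetP[[x|j] yq /= iE]; last by move: iq; rewrite iE yq.
  by apply/imsetP; exists x; rewrite ?inE.
exists [set x | inl x \in q], [set i | inr i \notin q]; split => //.
  have [i iq _] := dom x0; apply/set0Pn.
  have : i \in [set i | inr i \notin q] by rewrite inE.
  by move=> /(subsetP sub)/imsetP[x xs _]; exists x.
move=> y; have [i iq hi] := dom y; exists i; rewrite ?inE// => x.
by rewrite inE => /hi.
Qed.

(** * Scarf's lemma on the integer points of a dilated simplex *)

Section Grid.
Variables (I : finType) (N : nat).

Definition grid := {x : {ffun I -> 'I_N.+1} | \sum_i x i == N}.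

(** The coordinate [i], with ties broken by the enumeration because Scarf's lemma wants injective
    rankings; dividing by the number of grid points recovers the coordinate. *)
Definition grid_rank i (x : grid) : nat := val x i * #|{: grid}| + enum_rank x.

Lemma grid_rank_inj i : injective (grid_rank i).
Proof.
move=> x y /(congr1 (modn^~ #|{: grid}|)).
by rewrite !modnMDl !modn_small// => /val_inj/enum_rank_inj.
Qed.

Lemma grid_rank_le i x y : grid_rank i x <= grid_rank i y -> val x i <= val y i.
Proof.
have c0 : 0 < #|{: grid}| by apply/card_gt0P; exists x.
move=> /(leq_div2r #|{: grid}|).
by rewrite !divnMDl// !divn_small// !addn0.
Qed.

Lemma scarf_grid (i0 i1 : I) (c : grid -> I) : i1 != i0 ->
  exists (x0 : grid) (s : {set grid}) (C : {set I}), [/\ x0 \in s,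
    forall i, i \in C -> exists2 x, x \in s & c x = i,
    forall x y i, x \in s -> y \in s -> val x i < val y i + #|I| &
    forall x i, x \in s -> i \notin C -> val x i < #|I|].
Proof.
move=> i10.
have sum0 : \sum_i [ffun i => if i == i0 then @ord_max N else ord0] i == N.
  rewrite (bigD1 i0)//= ffunE eqxx big1 ?addn0// => i ii0.
  by rewrite ffunE (negPf ii0).
pose x0 : grid := Sub [ffun i => if i == i0 then @ord_max N else ord0] sum0.
have [s [C [s0 sC dom]]] := scarf x0 c i10 grid_rank_inj.
have [xs xss] := set0Pn _ s0; exists xs, s, C.
pose m i := val (val [arg min_(x < xs in s) val x i] i).
have m_le i x : x \in s -> m i <= val x i.
  by rewrite /m; case: arg_minnP => // y _ + xs'; exact.
have m_ex i : exists2 x, x \in s & m i = val x i.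
  by rewrite /m; case: arg_minnP => // y ys _; exists y.
have [ic icC _] := dom x0.
(* Otherwise a grid point with at least [(m i).+1] on [C], the remainder loaded on [ic] and 0
   elsewhere, would exceed the minimum of [s] at every index of [C]. Hence the points of [s] have
   less than [#|C|] units to distribute above these minima. *)
have mN : N < \sum_(i in C) (m i).+1.
  rewrite ltnNge; apply/negP => mN.
  pose y i := if i \in C then (m i).+1 + (i == ic) * (N - \sum_(i in C) (m i).+1)
    else 0.
  have ysum : \sum_i y i = N.
    rewrite -big_mkcond/= big_split/=; rewrite [X in _ + X](bigD1 ic)//= eqxx mul1n.
    by rewrite [X in _ + (_ + X)]big1 ?addn0 ?subnKC// => i /andP[_ /negbTE ->].
  have yN i : y i < N.+1 by rewrite ltnS -ysum (bigD1 i)//= leq_addr.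
  have yg : \sum_i [ffun i => Ordinal (yN i)] i == N.
    by apply/eqP; rewrite -[RHS]ysum; apply: eq_bigr => i _; rewrite ffunE.
  pose yp : grid := Sub [ffun i => Ordinal (yN i)] yg.
  have [i iC /= hi] := dom yp.
  have [x xs' mx] := m_ex i.
  have /= := grid_rank_le (hi _ xs').
  by rewrite ffunE /= /y iC -mx addSn ltnNge leq_addr.
have xN (x : grid) : \sum_i val x i = N by exact/eqP/(valP x).
have CI : #|C| <= #|I| by exact: max_card.
have sumC : \sum_(i in C) (m i).+1 = \sum_(i in C) m i + #|C|.
  by rewrite -sum1_card -big_split/=; apply: eq_bigr => i _; rewrite addn1.
have bndC x i : x \in s -> i \in C -> val x i < m i + #|I|.
  move=> xs' iC; apply: leq_trans (_ : m i + #|C| <= _); last by rewrite leq_add2l.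
  have h : val x i + \sum_(j in C | j != i) m j <= N.
    rewrite -[leqRHS](xN x) [leqRHS](bigID [in C])/= (bigD1 i iC)/= -addnA leq_add2l.
    rewrite (leq_trans _ (leq_addr _ _))//; apply: leq_sum => j _; exact: m_le.
  have := leq_ltn_trans h mN; rewrite sumC (bigD1 i iC)/=.
  by rewrite addnAC ltn_add2r.
have bndNC x i : x \in s -> i \notin C -> val x i < #|I|.
  move=> xs' iC; apply: leq_trans (_ : #|C| <= _) => //.
  have h : val x i + \sum_(j in C) m j <= N.
    rewrite -[leqRHS](xN x) [leqRHS](bigID [in C])/= addnC leq_add//.
      by apply: leq_sum => j _; exact: m_le.
    by rewrite (bigD1 i)//= leq_addr.
  by have := leq_ltn_trans h mN; rewrite sumC addnC ltn_add2l.
split=> // [i /(subsetP sC)/imsetP[x xs' ->]|x y i]; first by exists x.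
move=> xs' ys; have [iC|iC] := boolP (i \in C).
  by rewrite (leq_trans (bndC _ _ xs' iC))// leq_add2r m_le.
by rewrite (leq_trans (bndNC _ _ xs' iC))// leq_addl.
Qed.

End Grid.


From mathcomp Require Import all_order all_algebra.
From mathcomp Require Import all_classical all_reals all_analysis.
From mathcomp Require Import ring lra.

Import Order.TTheory GRing.Theory Num.Theory.
Import numFieldNormedType.Exports.

Local Open Scope classical_set_scope.
Local Open Scope ring_scope.

(** * Approximate Brouwer theorem *)

Definition simplex (R : realType) (I : finType) (a : I -> R) :=
  (forall i, 0 <= a i) /\ \sum_i a i = 1.

(** Each grid point is labelled by a coordinate that [G] does not decrease. On Scarf's set no
    coordinate can fall much: an index in [C] labels some nearby point, and the other coordinates
    are already close to 0. As both sums equal 1, no coordinate can rise much either. *)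
Lemma brouwer_approx (R : realType) (I : finType) (i0 i1 : I)
    (G : (I -> R) -> I -> R) (L : R) :
  i1 != i0 -> (forall a, simplex a -> simplex (G a)) ->
  (forall a b i, simplex a -> simplex b ->
    `|G a i - G b i| <= L * \sum_j `|a j - b j|) ->
  forall eps, 0 < eps -> exists2 a, simplex a & forall i, `|G a i - a i| <= eps.
Proof.
move=> i10 Gs GL eps eps0.
pose n : R := #|I|%:R.
have n0 : 0 < n by rewrite ltr0n; apply/card_gt0P; exists i0.
wlog L0 : L GL / 0 <= L.
  move=> /(_ `|L|); apply; last exact: normr_ge0.
  move=> a b i ha hb; rewrite (le_trans (GL _ _ _ ha hb))//.
  by rewrite ler_wpM2r ?sumr_ge0// ler_norm.
(* A coordinate falls by at most [(n + L * (n * n)) / N%:R]: the term [n] is the spread of the cell,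
   the other one its image under [G]. A rise is paid for by at most [n] such falls. *)
pose K := n * (n + L * (n * n)).
have K0 : 0 <= K by rewrite mulr_ge0 ?addr_ge0 ?mulr_ge0// ltW.
pose N := (Num.bound (K / eps)).+1.
have N0 : 0 < N%:R :> R by rewrite ltr0n.
have KN : K / N%:R <= eps.
  rewrite ler_pdivrMr// mulrC -ler_pdivrMr//.
  rewrite (le_trans (ltW (archi_boundP _)))// ?divr_ge0 ?(ltW eps0)//.
  by rewrite ler_nat.
pose a (x : grid I N) (i : I) : R := (val x i : nat)%:R / N%:R.
have as_ x : simplex (a x).
  split=> [i|]; first by rewrite divr_ge0.
  by rewrite -mulr_suml -natr_sum (eqP (valP x)) divff// gt_eqF.
have lab x : exists i, a x i <= G (a x) i.
  apply: contrapT => /forallNP nlab.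
  have [_ s1] := as_ x; have [_ s2] := Gs _ (as_ x).
  suff : \sum_i G (a x) i < \sum_i a x i by rewrite s1 s2 ltxx.
  apply: ltr_sum; last by move=> i _; rewrite ltNge; exact/negP.
  by apply/hasP; exists i0 => //; rewrite mem_index_enum.
have [c hc] := choice lab.
have [x [s [C [xs sC close out]]]] := scarf_grid c i10.
exists (a x) => //.
have aclose y i : y \in s -> `|a x i - a y i| <= n / N%:R.
  move=> ys; rewrite /a -mulrBl normrM [X in _ * X]ger0_norm ?invr_ge0 ?(ltW N0)//.
  rewrite ler_wpM2r ?invr_ge0 ?(ltW N0)// ler_distl lerBlDr.
  by rewrite -!natrD !ler_nat !(ltnW (close _ _ _ _ _)).
have low i : a x i - (n + L * (n * n)) / N%:R <= G (a x) i.
  have [iC|iC] := boolP (i \in C).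
    have [y ys iE] := sC _ iC.
    have h1 : a y i <= G (a y) i by rewrite -iE.
    have h2 := aclose y i ys.
    have h3 := GL _ _ i (as_ y) (as_ x).
    have h4 : \sum_j `|a y j - a x j| <= n * (n / N%:R).
      rewrite mulr_natl -sumr_const; apply: ler_sum => j _.
      by rewrite distrC aclose.
    have h5 := le_trans h3 (ler_wpM2l L0 h4).
    rewrite mulrDl -mulrA -mulrA.
    move: h2 h5; rewrite !ler_norml; lra.
  have h : a x i <= n / N%:R.
    by rewrite ler_wpM2r ?invr_ge0 ?(ltW N0)// ler_nat ltnW// out.
  have [g0 _] := Gs _ (as_ x); have := g0 i.
  have : 0 <= L * (n * n) / N%:R by rewrite !mulr_ge0 ?invr_ge0 ?(ltW n0) ?(ltW N0).
  rewrite mulrDl; lra.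
have d0 : 0 <= (n + L * (n * n)) / N%:R.
  by rewrite mulr_ge0 ?invr_ge0 ?(ltW N0)// addr_ge0 ?mulr_ge0 ?(ltW n0).
have n1 : 1 <= n by rewrite ler1n; apply/card_gt0P; exists i0.
have dK : (n + L * (n * n)) / N%:R <= eps.
  apply: le_trans KN; rewrite ler_wpM2r ?invr_ge0 ?(ltW N0)//.
  by rewrite /K ler_peMl// addr_ge0 ?mulr_ge0 ?(ltW n0).
move=> i; rewrite ler_norml; apply/andP; split; first by have := low i; lra.
have [_ s1] := as_ x; have [_ s2] := Gs _ (as_ x).
have -> : G (a x) i - a x i = \sum_(j | j != i) (a x j - G (a x) j).
  move: s1 s2; rewrite (bigD1 i)//= => s1; rewrite (bigD1 i)//= => s2.
  rewrite sumrB; lra.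
apply: le_trans KN; rewrite /K -mulrA.
apply: (@le_trans _ _ (\sum_(j : I | j != i) (n + L * (n * n)) / N%:R)).
  by apply: ler_sum => j _; have := low j; lra.
rewrite sumr_const -[leLHS]mulr_natl ler_wpM2r// ler_nat; exact: max_card.
Qed.

(** * Hahn-Banach theorem *)

Section HahnBanach.
Variables (R : realType) (V : lmodType R).
Implicit Types (q p : V -> R) (C : set V).

Definition sublinear q :=
  (forall u v, q (u + v) <= q u + q v) /\
  (forall a u, 0 <= a -> q (a *: u) = a * q u).

Definition convex_lmod C := forall x y t, C x -> C y -> 0 <= t <= 1 ->
  C (t *: x + (1 - t) *: y).

Lemma sublinearI q : q 0 = 0 -> (forall u v, q (u + v) <= q u + q v) ->
  (forall a u, 0 < a -> q (a *: u) <= a * q u) -> sublinear q.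
Proof.
move=> q0 qD qZ; split => // a u; rewrite le_eqVlt => /orP[/eqP <-|a0].
  by rewrite scale0r q0 mul0r.
apply/eqP; rewrite eq_le qZ//=.
have := qZ a^-1 (a *: u); rewrite invr_gt0 => /(_ a0).
by rewrite scalerA mulVf ?gt_eqF// scale1r mulrC ler_pdivlMr// mulrC.
Qed.

Lemma sublinear0 q : sublinear q -> q 0 = 0.
Proof. by move=> [_ /(_ 0 0 (lexx 0))]; rewrite scale0r mul0r. Qed.

Lemma sublinear_ge q : sublinear q -> forall v, - q (- v) <= q v.
Proof.
move=> q_sub v; have := q_sub.1 v (- v).
by rewrite subrr sublinear0//; lra.
Qed.

Lemma le_infD (A B : set R) (x : R) : A !=set0 -> B !=set0 ->
  (forall a b, A a -> B b -> x <= a + b) -> x <= inf A + inf B.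
Proof.
move=> A0 B0 h; rewrite -lerBlDr; apply: lb_le_inf => // a Aa.
rewrite lerBlDr -lerBlDl; apply: lb_le_inf => // b Bb.
by rewrite lerBlDl h.
Qed.

(** It lies below [q] and is at most [- d] at [- c] for [c] in [C], so a linear functional below it
    is at least [d] on [C]. Lowering along a singleton also shows that minimal sublinear functionals
    are additive. *)
Definition lowering q C (d : R) (w : V) : R :=
  inf [set z | exists s c, [/\ 0 <= s, C c & z = q (w + s *: c) - s * d]].

Section Lowering.
Variables (q : V -> R) (C : set V) (d : R).
Hypothesis q_sub : sublinear q.
Hypothesis C_conv : convex_lmod C.
Hypothesis C0 : C !=set0.
Hypothesis dq : forall c, C c -> d <= q c.
Local Notation Q := (lowering q C d).
Local Notation A w := [set z | exists s c, [/\ 0 <= s, C c & z = q (w + s *: c) - s * d]].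

Let A_neq0 w : A w !=set0.
Proof. by have [c Cc] := C0; exists (q (w + 0 *: c) - 0 * d), 0, c. Qed.

Let A_lb w : lbound (A w) (- q (- w)).
Proof.
move=> _ [s [c [s0 Cc ->]]]; have [qD qZ] := q_sub.
have := qD (w + s *: c) (- w); rewrite addrAC subrr add0r qZ//.
have := ler_wpM2l s0 (dq Cc); lra.
Qed.

Lemma lowering_le_shift w s c : 0 <= s -> C c -> Q w <= q (w + s *: c) - s * d.
Proof. by move=> s0 Cc; apply: ge_inf; [exists (- q (- w))|exists s, c]. Qed.

Lemma lowering_le w : Q w <= q w.
Proof.
have [c Cc] := C0; have := @lowering_le_shift w 0 c (lexx 0) Cc.
by rewrite scale0r addr0 mul0r subr0.
Qed.

Lemma lowering_sublinear : sublinear Q.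
Proof.
have [qD qZ] := q_sub; apply: sublinearI.
- apply/eqP; rewrite eq_le.
  rewrite -[X in Q 0 <= X](sublinear0 q_sub) lowering_le/=.
  have := @lb_le_inf _ _ _ (A_neq0 0) (@A_lb 0).
  by rewrite oppr0 (sublinear0 q_sub) oppr0.
- move=> u v; apply: le_infD => // _ _ [s [c [s0 Cc ->]]] [t [e [t0 Ce ->]]].
  have := s0; rewrite le_eqVlt => /orP[/eqP s00|sp].
    have := @lowering_le_shift (u + v) _ _ t0 Ce.
    have := qD u (v + t *: e).
    by rewrite -s00 scale0r !addrA addr0 mul0r; lra.
  have st0 : 0 < s + t by lra.
  (* Convexity of [C] merges the shifts by [s *: c] and [t *: e] into one shift of length [s + t]
     along a point of [C]. *)
  pose x := s / (s + t).
  have x01 : 0 <= x <= 1.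
    by rewrite divr_ge0 ?(ltW st0)//= ler_pdivrMr// mul1r lerDl.
  have := @lowering_le_shift (u + v) (s + t) _ (ltW st0) (C_conv Cc Ce x01).
  have -> : (s + t) *: (x *: c + (1 - x) *: e) = s *: c + t *: e.
    rewrite scalerDr !scalerA; congr (_ *: _ + _ *: _); rewrite /x; field;
      by rewrite gt_eqF.
  have := qD (u + s *: c) (v + t *: e).
  by rewrite addrACA; lra.
- move=> a u a0.
  rewrite mulrC -ler_pdivrMr//; apply: lb_le_inf => // _ [s [c [s0 Cc ->]]].
  rewrite ler_pdivrMr//.
  have := @lowering_le_shift (a *: u) (a * s) _ (mulr_ge0 (ltW a0) s0) Cc.
  by rewrite -scalerA -scalerDr qZ ?(ltW a0)//; lra.
Qed.

End Lowering.

(** Zorn's lemma for the reversed pointwise order. The infimum of a chain is finite because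
    sublinear functionals below [p] are at least [- p (- v)] at [v], and subadditive because two
    members of a chain are comparable. *)
Lemma minimal_sublinear p : sublinear p ->
  exists q, [/\ sublinear q, forall v, q v <= p v &
    forall q', sublinear q' -> (forall v, q' v <= q v) -> forall v, q' v = q v].
Proof.
move=> p_sub.
pose T := {q | sublinear q /\ forall v, q v <= p v}.
pose le (a b : T) := `[< forall v, sval b v <= sval a v >].
have [||||[q [q_sub qp]] qmin] := @Zorn T le.
- by move=> a; apply/asboolP => v.
- move=> b a c /asboolP ab /asboolP bc; apply/asboolP => v.
  exact: le_trans (bc v) (ab v).
- move=> [a ha] [b hb] /asboolP ab /asboolP ba.
  apply: eq_exist; apply/funext => v; apply/eqP.
  by rewrite eq_le; apply/andP; split; [exact: ba|exact: ab].
- move=> A Atot; have [[a0 Aa0]|A0] := pselect (A !=set0); last first.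
    exists (exist _ p (conj p_sub (fun v => lexx _))) => a Aa.
    by exfalso; apply: A0; exists a.
  pose B v := [set sval a v | a in A].
  have B0 v : B v !=set0 by exists (sval a0 v), a0.
  have Blb v : lbound (B v) (- p (- v)).
    move=> _ [[a [a_sub ap]] _ <-] /=; apply: le_trans (sublinear_ge a_sub v).
    by rewrite lerN2.
  have m_le a v : A a -> inf (B v) <= sval a v.
    by move=> Aa; apply: ge_inf; [exists (- p (- v))|exists a].
  have m_sub : sublinear (fun v => inf (B v)).
    apply: sublinearI.
    + apply/eqP; rewrite eq_le; apply/andP; split.
        by have := @m_le _ 0 Aa0; rewrite (sublinear0 (svalP a0).1).
      apply: lb_le_inf => // _ [a _ <-].
      by rewrite (sublinear0 (svalP a).1).
    + move=> u v; apply: le_infD => // _ _ [a Aa <-] [b Ab <-].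
      have [/asboolP ab|/asboolP ba] := Atot _ _ Aa Ab.
        apply: le_trans (m_le _ _ Ab) _.
        by apply: le_trans ((svalP b).1.1 _ _) _; rewrite lerD2r.
      apply: le_trans (m_le _ _ Aa) _.
      by apply: le_trans ((svalP a).1.1 _ _) _; rewrite lerD2l.
    + move=> x u x0; rewrite mulrC -ler_pdivrMr//.
      apply: lb_le_inf => // _ [a Aa <-].
      by rewrite ler_pdivrMr// mulrC -((svalP a).1.2 _ _ (ltW x0)) m_le.
  have m_p v : inf (B v) <= p v by apply: le_trans (m_le _ _ Aa0) ((svalP a0).2 v).
  exists (exist _ (fun v => inf (B v)) (conj m_sub m_p) : T) => a Aa.
  by apply/asboolP => v /=; exact: m_le.
exists q; split => // q' q'_sub q'q v.
have q'p w : q' w <= p w by exact: le_trans (q'q w) (qp w).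
have := qmin (exist _ q' (conj q'_sub q'p)).
have h : le (exist _ q (conj q_sub qp)) (exist _ q' (conj q'_sub q'p)).
  by apply/asboolP => w /=.
by move=> /(_ h) /(congr1 (fun a => sval a v)).
Qed.

(** By minimality, lowering [q] along [[set v]] by [q v] changes nothing, and the lowered functional
    is at most [q (u + v) - q v] at [u]: this is the missing half of additivity. *)
Lemma minimal_scalar q : sublinear q ->
  (forall q', sublinear q' -> (forall v, q' v <= q v) -> forall v, q' v = q v) ->
  scalar q.
Proof.
move=> q_sub qmin; have [qD qZ] := q_sub.
have qDE u v : q (u + v) = q u + q v.
  apply/eqP; rewrite eq_le qD/=.
  have c1 : convex_lmod [set v].
    by move=> x y t /= -> -> _; rewrite -scalerDl addrC subrK scale1r.
  have c0 : [set v] !=set0 by exists v.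
  have dq c : [set v] c -> q v <= q c by move=> ->.
  rewrite -(qmin _ (lowering_sublinear q_sub c1 c0 dq)); last first.
    by move=> w; exact: lowering_le.
  have := @lowering_le_shift q [set v] (q v) q_sub dq u 1 v ler01 erefl.
  by rewrite scale1r mul1r; lra.
have qN u : q (- u) = - q u.
  by have := qDE u (- u); rewrite subrr (sublinear0 q_sub); lra.
move=> a u v; rewrite qDE; congr (_ + _).
have [a0|a0] := leP 0 a; first exact: qZ.
have -> : a *: u = - ((- a) *: u) by rewrite scaleNr opprK.
by rewrite qN qZ ?oppr_ge0 ?ltW//= mulNr opprK.
Qed.

Theorem hahn_banach_convex p C (d : R) : sublinear p -> convex_lmod C ->
  C !=set0 -> (forall c, C c -> d <= p c) ->
  exists f : V -> R, [/\ scalar f, forall v, f v <= p v &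
    forall c, C c -> d <= f c].
Proof.
move=> p_sub C_conv C0 dp.
have [q [q_sub qp qmin]] := minimal_sublinear (lowering_sublinear p_sub C_conv C0 dp).
have q_lin := minimal_scalar q_sub qmin.
exists q; split => // [v|c Cc]; first exact: le_trans (qp v) (lowering_le p_sub C0 dp v).
have := qp (- c).
have := @lowering_le_shift p C d p_sub dp (- c) 1 c ler01 Cc.
rewrite scale1r addNr mul1r (sublinear0 p_sub).
have := q_lin 1 c (- c); rewrite scale1r subrr mul1r (sublinear0 q_sub); lra.
Qed.

End HahnBanach.

(** * Dual ball and weak topology *)

Section ScalarForm.
Variables (R : realType) (V : lmodType R) (f : V -> R).
Hypothesis f_lin : scalar f.

Lemma scalar_form0 : f 0 = 0.
Proof. have := f_lin 1 0 0; rewrite scaler0 addr0 mul1r; lra. Qed.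

Lemma scalar_formD u v : f (u + v) = f u + f v.
Proof. by have := f_lin 1 u v; rewrite scale1r mul1r. Qed.

Lemma scalar_formZ a u : f (a *: u) = a * f u.
Proof. by have := f_lin a u 0; rewrite !addr0 scalar_form0 addr0. Qed.

Lemma scalar_formN u : f (- u) = - f u.
Proof. by rewrite -scaleN1r scalar_formZ mulN1r. Qed.

Lemma scalar_formB u v : f (u - v) = f u - f v.
Proof. by rewrite scalar_formD scalar_formN. Qed.

Lemma scalar_form_sum (I : finType) (a : I -> R) (v : I -> V) :
  f (\sum_i a i *: v i) = \sum_i a i * f (v i).
Proof.
rewrite (big_morph f (id1 := 0) (op1 := +%R)).
- by apply: eq_bigr => i _; rewrite scalar_formZ.
- exact: scalar_formD.
- exact: scalar_form0.
Qed.

End ScalarForm.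

Lemma convex_lmodP (R : realType) (V : lmodType R) (C : set V) :
  convex_set C <-> convex_lmod C.
Proof.
split=> [h x y t Cx Cy t01|h x y l /set_mem Cx /set_mem Cy].
  have t0 : 0 <= t by case/andP: t01.
  have t1 : t <= 1 by case/andP: t01.
  have := h x y (@Itv01 R t t0 t1); rewrite !inE => /(_ Cx Cy).
  by [].
apply/mem_set; apply: h => //.
by rewrite ge0 le1.
Qed.

Section Dual.
Variables (R : realType) (E : normedModType R).
Implicit Types (f g : E -> R) (C : set E).

(** The unit ball of the dual, as plain functions so that pointwise combinations need no
    repackaging. By rescaling, it suffices for testing weak convergence. *)
Definition dual_ball : set (E -> R) :=
  [set f | scalar f /\ forall x, `|f x| <= `|x|].

Lemma norm_sublinear : sublinear (fun x : E => `|x|).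
Proof.
split=> [u v|a u a0]; first exact: ler_normD.
by rewrite normrZ ger0_norm.
Qed.

Lemma dual_ball_le f : scalar f -> (forall v, f v <= `|v|) -> dual_ball f.
Proof.
move=> f_lin fle; split=> // x; rewrite ler_norml fle andbT lerNl.
by rewrite -scalar_formN// -[leRHS]normrN fle.
Qed.

Lemma dual_ball0 : dual_ball (fun=> 0).
Proof. by split=> [a u v|x]; rewrite ?mulr0 ?addr0// normr0. Qed.

Lemma dual_ballN f : dual_ball f -> dual_ball (fun x => - f x).
Proof.
move=> [fl fb]; split=> [a u v|x]; last by rewrite normrN.
by rewrite fl opprD mulrN.
Qed.

Lemma dual_ball_conv f g t : dual_ball f -> dual_ball g -> 0 <= t <= 1 ->
  dual_ball (fun x => t * f x + (1 - t) * g x).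
Proof.
move=> [fl fb] [gl gb] /andP[t0 t1]; split=> [a u v|x].
  rewrite fl gl; ring.
rewrite (le_trans (ler_normD _ _))// !normrM (ger0_norm t0).
rewrite (@ger0_norm _ (1 - t)) ?subr_ge0//.
have := ler_wpM2l t0 (fb x); have : 0 <= 1 - t by lra.
move=> /ler_wpM2l/(_ _ _ (gb x)); lra.
Qed.

Lemma dual_ball_norm x : exists2 f, dual_ball f & f x = `|x|.
Proof.
have c1 : convex_lmod [set x].
  by move=> y z t /= -> -> _; rewrite -scalerDl addrC subrK scale1r.
have [||f [fl fle fx]] := hahn_banach_convex (d := `|x|) norm_sublinear c1.
- by exists x.
- by move=> c ->.
exists f; first exact: dual_ball_le.
by apply/eqP; rewrite eq_le fle fx.
Qed.

Lemma norm_le_dual x (c : R) : (forall f, dual_ball f -> f x <= c) -> `|x| <= c.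
Proof. by move=> h; have [f fb <-] := dual_ball_norm x; exact: h. Qed.

Lemma closed_convex_separation C x : closed C -> convex_lmod C -> C !=set0 ->
  ~ C x -> exists f delta, [/\ dual_ball f, 0 < delta &
    forall c, C c -> f x + delta <= f c].
Proof.
move=> C_closed C_conv [c0 Cc0] Cx.
have Co : open (~` C) by exact: closed_openC.
have /nbhs_ballP[d /= d0 dC] := open_nbhs_nbhs (conj Co Cx).
pose D := [set y | C (y + x)].
have D_conv : convex_lmod D.
  move=> y z t Dy Dz t01; rewrite /D/=.
  have -> : t *: y + (1 - t) *: z + x = t *: (y + x) + (1 - t) *: (z + x).
    rewrite !scalerDr addrACA -scalerDl; congr (_ + _).
    by rewrite addrCA subrr addr0 scale1r.
  exact: C_conv.
have D0 : D !=set0 by exists (c0 - x); rewrite /D/= subrK.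
have [|f [fl fle fd]] := hahn_banach_convex (d := d) norm_sublinear D_conv D0.
  move=> y Dy; rewrite leNgt; apply/negP => yd.
  apply: (dC (y + x)) => //; rewrite -ball_normE /ball_/=.
  by rewrite opprD addrCA subrr addr0 normrN.
exists f, d; split => //; first exact: dual_ball_le.
move=> c Cc; have := fd (c - x); rewrite /D/= subrK scalar_formB// => /(_ Cc).
lra.
Qed.

Lemma dual_ball_continuous f : dual_ball f -> continuous f.
Proof.
move=> [fl fb] x; apply/cvgrPdist_lt => e e0.
near=> y; rewrite -scalar_formB// (le_lt_trans (fb _))//.
Unshelve. all: by end_near. Qed.

Lemma weak_cvgP (F : set_system E) (x : E) : Filter F ->
  (F --> (x : weak E)) <-> (forall f, dual_ball f -> f @ F --> f x).
Proof.
move=> FF; split=> [Fx f fb|Fx].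
  have [fl _] := fb.
  pose L := GRing.isLinear.Build R E R^o *:%R (f : E -> R^o) fl.
  pose fL : {linear E -> R^o} := HB.pack_for {linear E -> R^o} (f : E -> R^o) L.
  have fc : continuous (fL : E -> R^o) by exact: dual_ball_continuous.
  have := (cvg_sup _ _ FF).1 Fx (exist _ fL fc) => Ff.
  apply: (@cvg_comp _ _ _ (id : E -> initial_topology (f : E -> R^o)) f F
    (nbhs (x : initial_topology (f : E -> R^o)))) => //.
  exact: (@initial_continuous _ _ (f : E -> R^o) x).
apply/cvg_sup => -[g gc].
have [M M0 gM] : exists2 M, 0 < M & forall y, `|g y| <= M * `|y|.
  have /linear_boundedP/pinfty_ex_gt0[M M0 gM] :=
    (linear_bounded_continuous g).2 gc.
  by exists M.
pose f (y : E) : R := M^-1 * g y.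
have fb : dual_ball f.
  split=> [a u v|y]; first by rewrite /f linearP mulrDr [LHS]/= (mulrCA M^-1 a).
  by rewrite /f normrM gtr0_norm ?invr_gt0// ler_pdivrMl.
have gF : g @ F --> g x.
  have -> : (g : E -> R^o) = (fun y => M * f y).
    by apply/funext => y; rewrite /f mulrA divff ?mul1r ?gt_eqF.
  by apply: cvgMr; exact: Fx.
move=> U /=; rewrite (@nbhsE (initial_topology (g : E -> R^o))).
move=> [B [[A Aop <-] Bx] BU]; apply: filterS BU _.
exact: gF _ (open_nbhs_nbhs (conj Aop Bx)).
Qed.

End Dual.

Section WeakTopology.
Variables (R : realType) (E : normedModType R).
Implicit Types (f g : E -> R) (F : set_system E) (X K : set E).
Local Notation ball1 := (@dual_ball R E).

Lemma dual_ball_weak_continuous f : ball1 f -> continuous (f : weak E -> R).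
Proof.
move=> fb x.
have FF := @nbhs_filter (weak E) x.
exact: (iffLR (@weak_cvgP R E _ x FF) _ f fb).
Qed.

(** Mazur's theorem for filters: a functional strictly separating [z] from [X] could not converge to
    its value at [z]. *)
Lemma weak_limit_closed X F z : closed X -> convex_lmod X -> ProperFilter F ->
  F X -> (forall f, ball1 f -> f @ F --> f z) -> X z.
Proof.
move=> X_closed X_conv FF FX Fz; apply: contrapT => Xz.
have X0 : X !=set0 by exact: filter_ex FX.
have [f [d [fb d0 fX]]] := closed_convex_separation X_closed X_conv X0 Xz.
have : f z + d <= f z.
  apply: (cvgr_to_ge (F := F) (f := f)); first exact: Fz.
  by apply: filterS FX => x /fX.
lra.
Qed.

Lemma weakly_compactP K : (forall F, UltraFilter F -> F K ->
    exists2 z, K z & forall f, ball1 f -> f @ F --> f z) <-> weakly_compact K.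
Proof.
rewrite /weakly_compact compact_ultra; split=> h F UF FK.
  by have [z Kz Fz] := h F UF FK; exists z; split => //; apply/weak_cvgP.
by have [z [Kz /weak_cvgP Fz]] := h F UF FK; exists z.
Qed.

Lemma weakly_compactI K X : weakly_compact K -> closed X -> convex_lmod X ->
  weakly_compact (K `&` X).
Proof.
move=> /weakly_compactP Kc Xc Xconv; apply/weakly_compactP => F UF FKX.
have [|z Kz Fz] := Kc F UF; first by apply: filterS FKX => x [].
exists z => //; split => //; apply: (weak_limit_closed Xc Xconv _ _ Fz).
by apply: filterS FKX => x [].
Qed.

Lemma ultra_cluster_cvg F f (p : R) : UltraFilter F -> cluster (f @ F) p ->
  f @ F --> p.
Proof.
move=> UF clp A Ap; have [//|FA] := in_ultra_setVsetC (f @^-1` A) UF.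
have [y [] ] := clp (~` A) A FA Ap.
by [].
Qed.

Lemma ultra_bounded_cvg F X (M : R) f : UltraFilter F -> F X ->
  (forall x, X x -> `|f x| <= M) -> exists p : R, f @ F --> p.
Proof.
move=> UF FX fM.
have [|p [_ clp]] := @segment_compact R (- M) M (fmap f F) _.
  change (F (f @^-1` `[- M, M]%classic)); apply: filterS FX => x /fM.
  by rewrite ler_norml => h; rewrite /= in_itv.
by exists p; exact: ultra_cluster_cvg.
Qed.

(** [phi] is the weak-star limit of the ultrafilter in the bidual. Weak compactness of a bounded
    closed convex [X] thus reduces to showing that such a [phi] is an evaluation. *)
Lemma ultra_limit_functional F X (M : R) : UltraFilter F -> F X ->
  (forall x, X x -> `|x| <= M) ->
  exists phi : (E -> R) -> R, forall f, ball1 f -> f @ F --> phi f.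
Proof.
move=> UF FX XM.
suff /choice[phi hphi] : forall f, exists p : R, ball1 f -> f @ F --> p.
  by exists phi.
move=> f; have [fb|nfb] := pselect (ball1 f); last by exists 0.
have [x Xx|p fp] := @ultra_bounded_cvg F X M f UF FX; last by exists p.
by rewrite (le_trans (fb.2 x))// XM.
Qed.

Section LimitFunctional.
Variables (F : set_system E) (phi : (E -> R) -> R).
Hypothesis F_proper : ProperFilter F.
Hypothesis phiP : forall f, ball1 f -> f @ F --> phi f.

Lemma limit_functional_conv f g t : ball1 f -> ball1 g -> 0 <= t <= 1 ->
  phi (fun x => t * f x + (1 - t) * g x) = t * phi f + (1 - t) * phi g.
Proof.
move=> fb gb t01.
apply: (cvg_unique _ (phiP (dual_ball_conv fb gb t01))).
  exact: norm_hausdorff.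
by apply: cvgD; apply: cvgMr; exact: phiP.
Qed.

Lemma limit_functional0 : phi (fun=> 0) = 0.
Proof.
apply: (cvg_unique _ (phiP (@dual_ball0 R E))); first exact: norm_hausdorff.
exact: cvg_cst.
Qed.

Lemma limit_functionalN f : ball1 f -> phi (fun x => - f x) = - phi f.
Proof.
move=> fb; apply: (cvg_unique _ (phiP (dual_ballN fb))).
  exact: norm_hausdorff.
by apply: cvgN; exact: phiP.
Qed.

Lemma limit_functional_le X f (c : R) : F X -> ball1 f ->
  (forall x, X x -> f x <= c) -> phi f <= c.
Proof.
move=> FX fb fc; apply: (cvgr_to_le (F := F) (f := f)); first exact: phiP.
by apply: filterS FX => x /fc.
Qed.

End LimitFunctional.

(* Helly's lemma: Hahn-Banach in the finite-dimensional space of the values of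
   [phi] and of the evaluations at the [x i]. *)
Lemma helly (phi : (E -> R) -> R) (I : finType) (x : I -> E) (d eta : R) :
  phi (fun=> 0) = 0 ->
  (forall f g t, ball1 f -> ball1 g -> 0 <= t <= 1 ->
    phi (fun x => t * f x + (1 - t) * g x) = t * phi f + (1 - t) * phi g) ->
  0 < d -> 0 < eta -> (forall z, exists2 f, ball1 f & d <= phi f - f z) ->
  exists f, [/\ ball1 f, `|phi f - d| < eta & forall i, `|f (x i)| < eta].
Proof.
move=> phi0 phiC d0 eta0 far; apply: contrapT => none.
pose V : lmodType R := (option I -> R^o).
pose vec f : V := fun o => if o is Some i then f (x i) else phi f - d.
pose q (v : V) : R := \sum_o `|v o|.
have q_sub : sublinear q.
  split=> [u v|a u a0]; rewrite /q.
    rewrite -big_split/=; apply: ler_sum => o _; exact: ler_normD.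
  by rewrite mulr_sumr; apply: eq_bigr => o _; rewrite normrM ger0_norm.
have coord (v : V) o : `|v o| <= q v.
  by rewrite /q (bigD1 o)//= lerDl sumr_ge0.
pose C : set V := [set vec f | f in ball1].
have C_conv : convex_lmod C.
  move=> _ _ t [f fb <-] [g gb <-] t01.
  exists (fun x => t * f x + (1 - t) * g x); first exact: dual_ball_conv.
  apply/funext => -[i|]; rewrite /vec //= phiC//.
  change (t * phi f + (1 - t) * phi g - d = t * (phi f - d) + (1 - t) * (phi g - d)).
  ring.
have C0 : C !=set0 by exists (vec (fun=> 0)), (fun=> 0) => //; exact: dual_ball0.
have qC v : C v -> eta <= q v.
  move=> [f fb <-]; rewrite leNgt; apply/negP => qeta; apply: none.
  exists f; split => // [|i]; first exact: le_lt_trans (coord (vec f) None) qeta.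
  exact: le_lt_trans (coord (vec f) (Some i)) qeta.
have [g [gl _ gC]] := hahn_banach_convex q_sub C_conv C0 qC.
pose e o : V := fun o' => (o' == o)%:R : R^o.
have gE (v : V) : g v = \sum_o v o * g (e o).
  rewrite -(scalar_form_sum gl); congr g; apply/funext => o.
  rewrite fct_sumE (bigD1 o)//= big1 ?addr0 => [|o' oo'].
    by rewrite /e scalrfctE eqxx [RHS]mulr1.
  by rewrite scalrfctE /e eq_sym (negPf oo') [LHS]mulr0.
have gvec f : ball1 f ->
    eta <= (phi f - d) * g (e None) + \sum_i f (x i) * g (e (Some i)).
  move=> fb; have : eta <= g (vec f) by apply: gC; exists f.
  rewrite gE (bigD1 None)//= (reindex_omap Some id)/=; last by case.
  by under eq_bigl do rewrite eqxx.
have gN : g (e None) < 0.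
  have := gvec _ (@dual_ball0 R E); rewrite phi0 sub0r big1; last first.
    by move=> i _; rewrite mul0r.
  rewrite addr0 => h; rewrite ltNge; apply/negP => gN.
  have : 0 <= d * g (e None) by rewrite mulr_ge0 // ltW.
  lra.
pose G := g (e None).
(* With [z] this combination, [gvec] reads [eta <= G * (phi f - d - f z)] for all [f] in the ball.
   As [G < 0], no [f] has [d <= phi f - f z], against [far]. *)
have [f fb] := far (\sum_i (- g (e (Some i)) / G) *: x i).
rewrite (scalar_form_sum fb.1) => hf.
have := gvec f fb.
have -> : \sum_i f (x i) * g (e (Some i)) = - G * \sum_i - g (e (Some i)) / G * f (x i).
  rewrite mulr_sumr; apply: eq_bigr => i _.
  by field; rewrite lt_eqF.
have : 0 <= (phi f - d - \sum_i - g (e (Some i)) / G * f (x i)) * (- G).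
  by rewrite mulr_ge0 ?subr_ge0 ?oppr_ge0 ?(ltW gN)//; lra.
rewrite -/G; lra.
Qed.

End WeakTopology.

(** * Limit functionals and weak compactness in a Banach space *)

Section Complete.
Variables (R : realType) (E : completeNormedModType R).
Implicit Types (f g : E -> R) (F : set_system E) (X K : set E).
Local Notation ball1 := (@dual_ball R E).

(** The norm is the supremum over the dual ball, so points whose evaluations approximate [phi]
    better and better form a Cauchy sequence; completeness provides the representing point. *)
Lemma approx_representable (phi : (E -> R) -> R) :
  (forall e, 0 < e -> exists z, forall f, ball1 f -> `|phi f - f z| <= e) ->
  exists z, forall f, ball1 f -> phi f = f z.
Proof.
move=> h.
have /choice[z hz] : forall n : nat, exists z, forall f, ball1 f ->
    `|phi f - f z| <= n.+1%:R^-1.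
  by move=> n; apply: h; rewrite invr_gt0.
have zclose m n : (m <= n)%N -> `|z m - z n| <= m.+1%:R^-1 + m.+1%:R^-1.
  move=> mn; apply: norm_le_dual => f fb; rewrite (scalar_formB fb.1).
  have mn' : n.+1%:R^-1 <= m.+1%:R^-1 :> R by rewrite lef_pV2 ?posrE// ler_nat.
  have := hz m f fb; have := hz n f fb.
  move: mn'; set a := n.+1%:R^-1; set b := m.+1%:R^-1.
  rewrite !ler_norml; lra.
have small (e : R) : 0 < e -> exists m, m.+1%:R^-1 < e.
  move=> e0; have [m _ hm] := near_infty_natSinv_lt (PosNum e0).
  by exists m; exact: hm (leqnn m).
have zcvg : cvg (z @ \oo).
  apply: cauchy_cvg; apply: cauchy_exP => e e0.
  have [m hm] := small _ (divr_gt0 e0 (ltr0n R 2)).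
  exists (z m); exists m => // n /= mn; rewrite -ball_normE /ball_/=.
  apply: le_lt_trans (zclose _ _ mn) _.
  by move: hm; set a := m.+1%:R^-1; lra.
exists (lim (z @ \oo)) => f fb.
have fz : (f \o z) @ \oo --> f (lim (z @ \oo)).
  by apply: continuous_cvg => //; exact: dual_ball_continuous.
apply: (cvg_unique _ _ fz); first exact: norm_hausdorff.
apply/cvgrPdist_lt => e e0; have [m hm] := small _ e0.
exists m => // n /= mn; apply: le_lt_trans (hz n f fb) _.
by apply: le_lt_trans hm; rewrite lef_pV2 ?posrE// ler_nat.
Qed.

(* Grothendieck's criterion: the cluster points, in the sets [K], of
   approximations of a limit functional form a Cauchy family. *)
Lemma weakly_compact_approx X (M : R) : closed X -> convex_lmod X ->
  (forall x, X x -> `|x| <= M) ->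
  (forall e, 0 < e -> exists2 K, weakly_compact K &
    forall x, X x -> exists2 k, K k & `|x - k| <= e) ->
  weakly_compact X.
Proof.
move=> Xc Xconv XM Xapprox; apply/weakly_compactP => F UF FX.
have [phi hphi] := ultra_limit_functional UF FX XM.
have [|z hz] := @approx_representable phi.
  move=> e e0; have [K Kc XK] := Xapprox _ e0.
  have /choice[kappa hk] : forall x, exists k, X x -> K k /\ `|x - k| <= e.
    move=> x; have [Xx|nXx] := pselect (X x); last by exists 0.
    by have [k Kk xk] := XK _ Xx; exists k.
  have [|k [Kk clk]] := Kc (fmap kappa F) _.
    by change (F (kappa @^-1` K)); apply: filterS FX => x /hk[].
  exists k => f fb; apply/ler_addgt0Pl => eta eta0.
  have h1 : F [set x | X x /\ `|phi f - f x| < eta / 2].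
    have /cvgrPdist_lt/(_ _ (divr_gt0 eta0 (ltr0n _ 2))) := hphi _ fb.
    exact: filterI.
  have h2 : nbhs (k : weak E) [set y | `|f k - f y| < eta / 2].
    have /cvgrPdist_lt := dual_ball_weak_continuous fb (x := k).
    by apply; rewrite divr_gt0.
  pose A := [set x | X x /\ `|phi f - f x| < eta / 2].
  have [|y [[x [Xx hx] <-] hy]] := clk (kappa @` A) _ _ h2.
    by change (F (kappa @^-1` (kappa @` A))); apply: filterS h1 => x hx; exists x.
  have [_ xk] := hk x Xx.
  have := fb.2 (x - kappa x); rewrite (scalar_formB fb.1) => h3.
  have := le_trans h3 xk; move: hx hy.
  rewrite /= !ltr_norml !ler_norml; lra.
exists z; last by move=> f fb; rewrite -hz//; exact: hphi.
apply: (weak_limit_closed Xc Xconv _ FX) => f fb.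
by rewrite -hz//; exact: hphi.
Qed.

End Complete.

(** * Simons' inequality and the Krein-Smulian theorem *)

Section Simons.
Variables (R : realType) (E : normedModType R).
Local Notation ball1 := (@dual_ball R E).

Lemma small_exp2 (e : R) : 0 < e -> exists n, 2^-1 ^+ n < e.
Proof.
move=> e0; have h : (fun n => 2^-1 ^+ n : R) @ \oo --> (0 : R).
  by apply: cvg_expr; rewrite ger0_norm; lra.
have /cvgrPdist_lt/(_ _ e0)[n _ /(_ n (leqnn n))] := h.
by rewrite /= sub0r normrN ger0_norm ?exprn_ge0//; exists n.
Qed.

Variables (K : set E) (M : R) (C : nat -> set (E -> R)).
Hypothesis K_compact : weakly_compact K.
Hypothesis K0 : K !=set0.
Hypothesis KM : forall x, K x -> `|x| <= M.
Hypothesis C_ball : forall n, C n `<=` ball1.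
Hypothesis C_decr : forall n, C n.+1 `<=` C n.
Hypothesis C_mid : forall n f g, C n f -> C n g ->
  C n (fun x => 2^-1 * f x + 2^-1 * g x).
Hypothesis C_neq0 : forall n, C n !=set0.

Local Notation r n := (2^-1 ^+ n : R).

Let r_gt0 n : 0 < r n. Proof. by rewrite exprn_gt0. Qed.

Let rS n : r n.+1 = r n / 2. Proof. by rewrite exprSr. Qed.

Let M_ge0 : 0 <= M.
Proof. by have [x /KM] := K0; apply: le_trans. Qed.

Let CM n f x : C n f -> K x -> `|f x| <= M.
Proof. by move=> /C_ball[_ fb] /KM; exact: le_trans. Qed.

(** The infimum over [C n] of the supremum on [K] need not be attained, hence the error [e]. Suprema
    are expressed by their upper bounds [c]. *)
Lemma almost_minimizer n (e : R) (z : E -> R) : 0 < e ->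
  (forall x, `|z x| <= `|x|) ->
  exists2 y, C n y & forall y' c, C n y' ->
    (forall b, K b -> z b + r n * y' b <= c) ->
    forall b, K b -> z b + r n * y b <= c + e.
Proof.
move=> e0 zb.
pose A := [set c | exists2 y', C n y' & forall b, K b -> z b + r n * y' b <= c].
have [b0 Kb0] := K0.
have r1 : r n <= 1 by rewrite exprn_ile1//; lra.
have bnd y b : C n y -> K b -> `|z b + r n * y b| <= M + M.
  move=> Cy Kb; rewrite (le_trans (ler_normD _ _))// lerD//.
    by rewrite (le_trans (zb _))// KM.
  rewrite normrM gtr0_norm// (le_trans _ (CM Cy Kb))//.
  by rewrite ler_piMl.
have A_inf : has_inf A.
  split.
    have [y Cy] := C_neq0 n; exists (M + M), y => // b Kb.
    by rewrite (le_trans (ler_norm _))// bnd.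
  exists (- (M + M)) => c [y Cy hy].
  have := hy _ Kb0; apply: le_trans.
  by have := bnd _ _ Cy Kb0; rewrite ler_norml => /andP[].
have [c [y Cy hy] cinf] := inf_adherent e0 A_inf.
exists y => // y' c' Cy' hc' b Kb.
rewrite (le_trans (hy _ Kb))// (le_trans (ltW cinf))// lerD2r.
by apply: (ge_inf A_inf.2); exists y'.
Qed.

Variables (c : R).
Hypothesis c_gt0 : 0 < c.
Hypothesis C_sup : forall g c', C 0 g -> c' < c -> exists2 b, K b & c' < g b.
Hypothesis C_small : forall b e, K b -> 0 < e ->
  exists n, forall g, C n g -> g b <= e.

(* The series [z] of the [2^-(n+1) y_n], with [y_n] almost minimizing
   [sup_K (z_n + 2^-n y)] over [C n], attains its maximum on [K] at some [b];
   comparing partial sums at [b] shows that the [y_n b] do not tend to 0. *)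
Lemma simons : False.
Proof.
(* The argument ends with [c - 2 * e <= z b] and [z b <= e + 2 * e * (1 - r N)], which are
   incompatible once [c] is at least [5 * e]; 8 leaves a margin. *)
pose e := c / 8.
have e0 : 0 < e by rewrite divr_gt0.
have /choice[Y hY] : forall p : nat * (E -> R), exists y,
    C p.1 y /\ ((forall x, `|p.2 x| <= `|x|) ->
    forall y' c, C p.1 y' ->
    (forall b, K b -> p.2 b + r p.1 * y' b <= c) ->
    forall b, K b -> p.2 b + r p.1 * y b <= c + e * r p.1 ^+ 2).
  move=> [n z] /=.
  have [zb|nzb] := pselect (forall x, `|z x| <= `|x|); last first.
    by have [y Cy] := C_neq0 n; exists y; split.
  have er0 : 0 < e * r n ^+ 2 by rewrite mulr_gt0// exprn_gt0.
  by have [y Cy hy] := almost_minimizer n er0 zb; exists y.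
pose zs := fix zs n := if n is m.+1 then
  (fun x => zs m x + r m.+1 * Y (m, zs m) x) else (fun=> 0 : R).
pose y n := Y (n, zs n).
have zs0 x : zs 0%N x = 0 by [].
have zsS n x : zs n.+1 x = zs n x + r n.+1 * y n x by [].
have Cy n : C n (y n) by have [] := hY (n, zs n).
have yb n : ball1 (y n) by exact: C_ball (Cy n).
have zsb n x : `|zs n x| <= (1 - r n) * `|x|.
  elim: n => [|n IH]; first by rewrite expr0 subrr mul0r normr0.
  rewrite zsS (le_trans (ler_normD _ _))// normrM gtr0_norm//.
  have := ler_wpM2l (ltW (r_gt0 n.+1)) ((yb n).2 x).
  rewrite rS in IH *; lra.
have zsb1 n x : `|zs n x| <= `|x|.
  by rewrite (le_trans (zsb n x))// ler_piMl// lerBlDr lerDl ltW.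
have zs_lin n : scalar (zs n).
  elim: n => [|n IH] a u v; first by rewrite /= mulr0 addr0.
  rewrite !zsS IH (yb n).1; ring.
have y_min n y' d : C n y' -> (forall b, K b -> zs n b + r n * y' b <= d) ->
    forall b, K b -> zs n b + r n * y n b <= d + e * r n ^+ 2.
  by have [_ /(_ (zsb1 n) y' d)] := hY (n, zs n).
(* [r n] is [r n.+1 + ... + r (n + k)] plus [r (n + k)] once more, so the terms added after rank [n]
   average, by iterated midpoints, to a single competitor in [C n]. *)
have tail k n y' : C (n + k)%N y' -> exists2 w, C n w &
    forall x, zs (n + k)%N x + r (n + k)%N * y' x = zs n x + r n * w x.
  elim: k y' => [|k IH] y'; first by rewrite addn0 => Cy'; exists y'.
  rewrite addnS => /C_decr Cy'.
  have [w Cw hw] := IH _ (C_mid (Cy (n + k)%N) Cy'); exists w => // x.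
  by rewrite -hw zsS rS; lra.
(* Adding the bound of the remainder makes the partial sums monotone, so their limit is an
   infimum. *)
pose a x n := zs n x + r n * `|x|.
have a_decr x : nonincreasing_seq (a x).
  apply/nonincreasing_seqP => n; rewrite /a zsS.
  have := ler_wpM2l (ltW (r_gt0 n.+1)) (le_trans (ler_norm _) ((yb n).2 x)).
  rewrite rS; lra.
have a_lb x : has_lbound (range (a x)).
  exists (- `|x|) => _ [n _ <-]; rewrite /a.
  have := zsb1 n x; rewrite ler_norml => /andP[h _].
  by rewrite (le_trans h)// lerDl mulr_ge0// ltW.
pose z x := inf (range (a x)).
have a_cvg x : a x @ \oo --> z x by exact: nonincreasing_cvgn.
have r_cvg : (fun n => r n) @ \oo --> (0 : R).
  by apply: cvg_expr; rewrite ger0_norm; lra.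
have zs_cvg x : (zs ^~ x) @ \oo --> z x.
  have -> : (zs ^~ x) = (fun n => a x n - r n * `|x|).
    by apply/funext => n; rewrite /a addrK.
  rewrite -[z x]subr0 -[X in _ - X](mul0r `|x|).
  by apply: cvgB => //; apply: cvgMl.
have z_lin : scalar z.
  move=> t u v; apply: (cvg_unique _ (zs_cvg _)); first exact: norm_hausdorff.
  have -> : zs^~ (t *: u + v) = (fun n => t * zs n u + zs n v).
    by apply/funext => n; rewrite zs_lin.
  by apply: cvgD => //; apply: cvgMr.
have z_le n x : z x <= zs n x + r n * `|x|.
  by apply: ge_inf => //; exists n.
have z_ge n x : zs n x - r n * `|x| <= z x.
  have := z_le n (- x).
  rewrite (scalar_formN z_lin) (scalar_formN (zs_lin n)) normrN; lra.
have zb : ball1 z.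
  apply: dual_ball_le => // x; have := z_le 0 x.
  by rewrite expr0 mul1r add0r.
have [|b Kb zmax] := @compact_EVT_max (weak E) R z K K0 K_compact.
  by apply: continuous_subspaceT; exact: dual_ball_weak_continuous.
move: Kb => /set_mem Kb.
have {}zmax x : K x -> z x <= z b by move=> Kx; apply: zmax; exact/mem_set.
(* The competitor [w] stands for the terms up to a far rank, where the partial sum is almost [z],
   hence almost at most [z b] on [K]; near minimality transfers this bound to [y n]. *)
have claim1 n x : K x -> zs n x + r n * y n x <= z b + e * r n ^+ 2.
  move=> Kx; apply/ler_addgt0Pr => d d0.
  have [k hk] : exists k, r k * (2 * (M + 1)) < d.
    have M1 : 0 < 2 * (M + 1) by have := M_ge0; lra.
    by have [k hk] := small_exp2 (divr_gt0 d0 M1); exists k; rewrite -ltr_pdivlMr.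
  have [w Cw hw] := tail k n _ (Cy (n + k)%N).
  rewrite [leRHS]addrAC; apply: (y_min n w) => // x' Kx'; rewrite -hw.
  have rk : r (n + k)%N <= r k by rewrite exprD ler_piMl ?exprn_ile1//; lra.
  set N := (n + k)%N in rk *.
  have h1 := ler_wpM2l (ltW (r_gt0 N)) (le_trans (ler_norm _) (CM (Cy N) Kx')).
  have h2 := ler_wpM2l (ltW (r_gt0 N)) (KM Kx').
  have h3 : r N * (2 * (M + 1)) <= r k * (2 * (M + 1)).
    by rewrite ler_wpM2r//; have := M_ge0; lra.
  have := z_ge N x'; have := zmax _ Kx'; have := r_gt0 N; lra.
(* By the first claim at [b], the gap [z b - zs n b] is at least halved in a controlled way at each
   step: beyond halving it loses at most [e * r n ^+ 2 / 2]. Relative to [r n], these losses add up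
   to [2 * e * (1 - r n)]. *)
have claim2 n : r n * (z b - 2 * e * (1 - r n)) <= z b - zs n b.
  elim: n => [|n IH]; first by rewrite expr0 subrr mulr0 mul1r zs0.
  have := claim1 n b Kb; rewrite zsS rS.
  have : 0 <= e * r n ^+ 2 by rewrite mulr_ge0 ?exprn_ge0 ?ltW.
  lra.
have zb_ge : c - 2 * e <= z b.
  have [|b' Kb' hb'] := C_sup (Cy 0) (c' := c - e); first by lra.
  have := claim1 0 b' Kb'; rewrite zs0 expr0 expr1n !mulr1 mul1r add0r; lra.
have [N hN] := C_small Kb e0.
have CN k : C (N + k)%N `<=` C N.
  elim: k => [|k IH]; first by rewrite addn0.
  by rewrite addnS => f /C_decr; exact: IH.
have growth k : zs (N + k)%N b <= zs N b + e * (r N - r (N + k)%N).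
  elim: k => [|k IH]; first by rewrite addn0 subrr mulr0 addr0.
  have := ler_wpM2l (ltW (r_gt0 (N + k).+1%N)) (hN _ (CN _ _ (Cy (N + k)%N))).
  rewrite addnS zsS rS; lra.
have zN : z b <= zs N b + e * r N.
  apply: (cvgr_to_le (zs_cvg b)); exists N => // n /= Nn.
  have := growth (n - N)%N; rewrite subnKC//.
  have : 0 <= e * r n by rewrite mulr_ge0 ?ltW.
  lra.
have := claim2 N.
have : z b - 2 * e * (1 - r N) <= e -> False.
  have : 0 <= e * r N by rewrite mulr_ge0 ?ltW.
  have : c = 8 * e by rewrite /e; field.
  lra.
move=> h1 h2; apply: h1; rewrite -(ler_pM2l (r_gt0 N)); lra.
Qed.

End Simons.

Section Krein.
Variables (R : realType) (E : completeNormedModType R).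
Local Notation ball1 := (@dual_ball R E).

(* Krein-Smulian theorem for a separable hull [X] of a sequence [k]: if a limit
   functional [phi] on [X] is far from all evaluations, Helly's lemma provides
   functionals which tend to 0 pointwise on [X] while [phi] is large on them,
   contradicting Simons' inequality. *)
Lemma weakly_compact_hull (K X : set E) (M : R) (k d : nat -> E) :
  weakly_compact K -> (forall n, K (k n)) -> (forall n, X (k n)) ->
  (forall n, `|k n| <= M) -> closed X -> convex_lmod X ->
  X `<=` closure (range d) ->
  (forall f c, ball1 f -> (forall n, f (k n) <= c) -> forall x, X x -> f x <= c) ->
  weakly_compact X.
Proof.
move=> Kc Kk Xk kM Xc Xconv Xd Xsup; apply/weakly_compactP => F UF FX.
have XM x : X x -> `|x| <= M.
  move=> Xx; apply: norm_le_dual => f fb; apply: (Xsup _ _ fb _ _ Xx) => n.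
  by rewrite (le_trans (ler_norm _))// (le_trans (fb.2 _)).
have [phi hphi] := ultra_limit_functional UF FX XM.
have FF : ProperFilter F by exact: ultra_proper.
suff [z hz] : exists z, forall f, ball1 f -> phi f = f z.
  exists z; last by move=> f fb; rewrite -hz//; exact: hphi.
  by apply: (weak_limit_closed Xc Xconv _ FX) => f fb; rewrite -hz//; exact: hphi.
apply: approx_representable; apply: contrapT => nrep.
have [dl dl0 far] : exists2 dl, 0 < dl &
    forall z, exists2 f, ball1 f & dl <= phi f - f z.
  apply: contrapT => nfar; apply: nrep => e e0; apply: contrapT => nz.
  apply: nfar; exists e => // z; apply: contrapT => nf; apply: nz.
  exists z => f fb; rewrite leNgt; apply/negP => lt_e; apply: nf.
  have [fz|fz] := leP 0 (phi f - f z).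
    by exists f => //; rewrite ltW// -(ger0_norm fz).
  exists (fun x => - f x); first exact: dual_ballN.
  by rewrite (limit_functionalN FF hphi fb) -opprD -(ltr0_norm fz) ltW.
(* Helly's lemma with tolerance at most [dl / 2] makes these sets nonempty. The bound tightens as
   the list of points grows, so density of [d] forces smallness at each point of [X]. *)
pose C n := [set f | [/\ ball1 f, dl / 2 <= phi f &
  forall m, (m < n)%N -> `|f (d m)| <= n.+1%:R^-1]].
have half01 : 0 <= (2^-1 : R) <= 1 by lra.
have halfE : 1 - 2^-1 = 2^-1 :> R by lra.
have supC g c' : C 0%N g -> c' < dl / 2 -> exists2 b, (K `&` X) b & c' < g b.
  move=> [gb gphi _] c'dl; apply: contrapT => nb.
  suff : phi g <= c' by lra.
  apply: (limit_functional_le FF hphi FX gb); apply: (Xsup _ _ gb) => n.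
  rewrite leNgt; apply/negP => lt_c'; apply: nb.
  by exists (k n) => //; split.
apply: (@simons R E (K `&` X) M C _ _ _ _ _ _ _ (dl / 2)) => //.
- exact: weakly_compactI.
- by exists (k 0%N); split.
- by move=> x [_ /XM].
- by move=> n f [].
- move=> n f [fb fphi fd]; split => // m mn.
  rewrite (le_trans (fd _ (ltn_trans mn (ltnSn n))))//.
  by rewrite lef_pV2 ?posrE// ler_nat.
- move=> n f g [fb fphi fd] [gb gphi gd]; split.
  + by have := dual_ball_conv fb gb half01; rewrite halfE.
  + have := limit_functional_conv FF hphi fb gb half01; rewrite halfE => ->; lra.
  + move=> m mn; have := fd m mn; have := gd m mn.
    set a := n.+1%:R^-1; rewrite !ler_norml; lra.
- move=> n.
  have eta0 : 0 < Num.min (dl / 2) n.+1%:R^-1 by rewrite lt_min divr_gt0//= invr_gt0.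
  have [f [fb fphi fd]] := @helly R E phi 'I_n (fun i => d i) dl _
    (limit_functional0 FF hphi) (limit_functional_conv FF hphi) dl0 eta0 far.
  exists f; split => // [|m mn].
    move: fphi; rewrite lt_min => /andP[]; rewrite ltr_norml; lra.
  by have := fd (Ordinal mn); rewrite lt_min => /andP[_ /ltW].
- by rewrite divr_gt0.
- move=> b e [_ Xb] e0.
  have e20 : 0 < e / 2 by rewrite divr_gt0.
  have [_ [[m _ <-]]] := Xd _ Xb _ (nbhsx_ballx b _ e20).
  rewrite -ball_normE /ball_/= => bm.
  have [p _ /(_ _ (leqnn p)) /= hp] := near_infty_natSinv_lt (PosNum e20).
  exists (maxn m.+1 p) => g [gb _ gd].
  have h1 := gd m (leq_maxl _ _).
  have h2 : (maxn m.+1 p).+1%:R^-1 <= p.+1%:R^-1 :> R.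
    by rewrite lef_pV2 ?posrE// ler_nat ltnS leq_maxr.
  have h3 := gb.2 (b - d m); rewrite (scalar_formB gb.1) in h3.
  have h4 := le_lt_trans h3 bm.
  have h5 := le_lt_trans (le_trans h1 h2) hp.
  move: h4 h5; rewrite !ltr_norml; lra.
Qed.

End Krein.

(** * Separable weakly compact sets *)

Section MidpointClosure.
Variables (R : realType) (V : lmodType R) (a : nat -> V) (t : V -> V).

(** It serves twice: with a contraction of the selection for [t], and with [t] the identity, when
    its closure is the closed convex hull of the [a n]. *)
Inductive generated : V -> Prop :=
| generated_base n : generated (a n)
| generated_map x : generated x -> generated (t x)
| generated_mid x y : generated x -> generated y ->
    generated (2^-1 *: (x + y)).

Fixpoint generated_eval (s : GenTree.tree nat) : V :=
  match s with
  | GenTree.Leaf n => a n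
  | GenTree.Node _ [:: s1] => t (generated_eval s1)
  | GenTree.Node _ [:: s1; s2] =>
      2^-1 *: (generated_eval s1 + generated_eval s2)
  | _ => a 0%N
  end.

Lemma generated_enum : exists d : nat -> V, range d = generated.
Proof.
(* Testing membership before accepting a value avoids an induction on nested trees; codes without a
   tree fall back on [a 0]. *)
pose d n := if unpickle n is Some s then
  if `[< generated (generated_eval s) >] then generated_eval s else a 0%N
  else a 0%N.
exists d; apply/seteqP; split=> [_ [n _ <-]|x gx].
  rewrite /d; case: (unpickle n) => [s|]; last exact: generated_base.
  by case: asboolP => // _; exact: generated_base.
have [s sx] : exists s, generated_eval s = x.
  elim: gx => [n|y _ [s <-]|y z _ [s <-] _ [s' <-]].
  - by exists (GenTree.Leaf n).
  - by exists (GenTree.Node 0 [:: s]).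
  - by exists (GenTree.Node 0 [:: s; s']).
exists (pickle s) => //; rewrite /d pickleK sx.
by case: asboolP.
Qed.

End MidpointClosure.

Section ConvexClosure.
Variables (R : realType) (E : normedModType R).
Implicit Types (X D : set E).

Definition midpoint_closed D := forall x y, D x -> D y -> D (2^-1 *: (x + y)).

Lemma closure_midpoint_closed D : midpoint_closed D -> midpoint_closed (closure D).
Proof.
move=> Dm x y Dx Dy A /nbhs_ballP[e /= e0 eA].
have [x' [Dx' xx']] := Dx _ (nbhsx_ballx x _ e0).
have [y' [Dy' yy']] := Dy _ (nbhsx_ballx y _ e0).
exists (2^-1 *: (x' + y')); split; first exact: Dm.
apply: eA; move: xx' yy'; rewrite -!ball_normE /ball_/= => xx' yy'.
rewrite -scalerBr opprD addrACA normrZ ger0_norm; last by lra.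
have := ler_normD (x - x') (y - y'); lra.
Qed.

(** Binary expansion of [t]: passing to [2 * t] or [2 * t - 1] costs one midpoint with [y] or [x]
    and halves the error. *)
Lemma closed_midpoint_convex X : closed X -> midpoint_closed X -> convex_lmod X.
Proof.
move=> Xc Xm x y t Xx Xy t01; apply: Xc => A /nbhs_ballP[e /= e0 eA].
have approx n : forall t, 0 <= t <= 1 -> exists2 s, X (s *: x + (1 - s) *: y) &
    `|t - s| <= 2^-1 ^+ n.
  elim: n => [|n IH] u u01.
    exists 0; first by rewrite scale0r add0r subr0 scale1r.
    by rewrite subr0 expr0 ger0_norm; lra.
  have [u2|u2] := leP u 2^-1.
    have [|s Xs us] := IH (2 * u); first by lra.
    exists (2^-1 * s).
      have := Xm _ _ Xs Xy; congr X.
      rewrite -addrA -[X in _ + (_ + X)]scale1r -scalerDl scalerDr !scalerA.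
      by congr (_ + _ *: _); lra.
    rewrite exprS; move: us; rewrite !ler_norml; lra.
  have [|s Xs us] := IH (2 * u - 1); first by lra.
  exists (2^-1 * (s + 1)).
    have := Xm _ _ Xs Xx; congr X.
    rewrite addrAC -[X in _ + X + _]scale1r -scalerDl scalerDr !scalerA.
    by congr (_ + _ *: _); lra.
  rewrite exprS; move: us; rewrite !ler_norml; lra.
have xy0 : 0 < `|x - y| + 1 by rewrite ltr_wpDl.
have [n hn] := small_exp2 (divr_gt0 e0 xy0).
have [s Xs ts] := approx n _ t01.
exists (s *: x + (1 - s) *: y); split => //; apply: eA.
rewrite -ball_normE /ball_/=.
have -> : t *: x + (1 - t) *: y - (s *: x + (1 - s) *: y) = (t - s) *: (x - y).
  rewrite opprD addrACA -!scalerBl scalerBr -scalerN; congr (_ + _).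
  by rewrite scalerN -scaleNr; congr (_ *: _); lra.
rewrite normrZ; move: hn; rewrite ltr_pdivlMr// => hn.
apply: le_lt_trans hn; apply: ler_pM => //.
by rewrite lerDl.
Qed.

End ConvexClosure.

Section SequentialCompactness.
Variables (R : realType) (E : normedModType R).
Local Notation ball1 := (@dual_ball R E).

Lemma weak_cvg_seqP (u : nat -> E) (l : E) :
  weak_cvg u l <-> (forall f, ball1 f -> f (u n) @[n --> \oo] --> f l).
Proof. exact: (@weak_cvgP R E (fmap u \oo) l _). Qed.

Lemma separating_sequence (K : set E) (d : nat -> E) : K `<=` closure (range d) ->
  exists g : nat -> E -> R, (forall i, ball1 (g i)) /\
    forall x y, K x -> K y -> (forall i, g i x = g i y) -> x = y.
Proof.
move=> Kd.
have /choice[F hF] : forall p : nat * nat, exists f, ball1 f /\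
    f (d p.1 - d p.2) = `|d p.1 - d p.2|.
  by move=> p; have [f fb fp] := dual_ball_norm (d p.1 - d p.2); exists f.
pose g i := F (odflt (0%N, 0%N) (unpickle i)).
have gb i : ball1 (g i) by have [] := hF (odflt (0%N, 0%N) (unpickle i)).
exists g; split => // x y Kx Ky gxy; apply/eqP; rewrite -subr_eq0 -normr_le0.
apply/ler_addgt0Pl => e e0.
have e40 : 0 < e / 4 by rewrite divr_gt0.
have [_ [[m _ <-]]] := Kd _ Kx _ (nbhsx_ballx x _ e40).
have [_ [[n _ <-]]] := Kd _ Ky _ (nbhsx_ballx y _ e40).
rewrite -!ball_normE /ball_/= => yn xm.
have [fb fE] := hF (m, n); have fxy := gxy (pickle (m, n)).
rewrite /g pickleK /= in fxy; move: fE fb fxy; set f := F (m, n) => /= fE fb fxy.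
have h1 := le_lt_trans (fb.2 (x - d m)) xm.
have h2 := le_lt_trans (fb.2 (y - d n)) yn.
move: fE h1 h2; rewrite !(scalar_formB fb.1) fxy !ltr_norml => fE h1 h2.
have -> : x - y = (x - d m) + (d m - d n) - (y - d n).
  by rewrite opprB !subrKA.
have h3 := ler_normB ((x - d m) + (d m - d n)) (y - d n).
have h4 := ler_normD (x - d m) (d m - d n).
lra.
Qed.

Lemma weakly_seq_compact (K : set E) (d u : nat -> E) :
  weakly_compact K -> K `<=` closure (range d) -> (forall n, K (u n)) ->
  exists2 k : nat -> nat, {homo k : m n / (m < n)%N} &
    exists2 z, K z & weak_cvg (u \o k) z.
Proof.
move=> Kc Kd Ku.
have [g [gb separating]] := separating_sequence Kd.
have clusterK (v : nat -> E) : (forall n, K (v n)) -> exists2 z, K z &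
    forall B, nbhs (z : weak E) B -> forall N, exists2 n, (N <= n)%N & B (v n).
  move=> Kv; have [|z [Kz clz]] := Kc (fmap v \oo) _.
    by exists 0%N => // n _; exact: Kv.
  exists z => // B zB N.
  have [|y [[n Nn <-] By]] := clz (v @` [set n | (N <= n)%N]) B _ zB.
    by exists N => // n Nn; exists n.
  by exists n.
have [z Kz clz] := clusterK _ Ku.
have near_z f e : ball1 f -> 0 < e -> nbhs (z : weak E) [set y | `|f z - f y| < e].
  move=> fb e0; have /cvgrPdist_lt := dual_ball_weak_continuous fb (x := z).
  exact.
have near_fin j e : 0 < e ->
    nbhs (z : weak E) [set y | forall i, (i < j)%N -> `|g i z - g i y| < e].
  move=> e0; elim: j => [|j IH].
    apply: (@filterS _ _ (@nbhs_filter (weak E) z) setT) => //.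
    exact: (@filterT _ _ (@nbhs_filter (weak E) z)).
  have := @filterI _ _ (@nbhs_filter (weak E) z) _ _ IH (near_z (g j) _ (gb j) e0).
  apply: (@filterS _ _ (@nbhs_filter (weak E) z)) => y [h1 h2] i.
  by rewrite ltnS leq_eqVlt => /orP[/eqP ->|/h1].
have /choice[nxt hnxt] : forall p : nat * nat, exists n, (p.1 <= n)%N /\
    forall i, (i < p.2)%N -> `|g i z - g i (u n)| < p.2.+1%:R^-1.
  move=> [N j] /=; have [|n Nn hn] := clz _ (near_fin j j.+1%:R^-1 _) N.
    by rewrite invr_gt0.
  by exists n.
pose k := fix k j := if j is i.+1 then nxt ((k i).+1, j) else nxt (0%N, 0%N).
have k_incr : {homo k : m n / (m < n)%N}.
  apply: homo_ltn; first exact: ltn_trans.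
  by move=> i; have [] := hnxt ((k i).+1, i.+1).
have k_near i j : (i < j)%N -> `|g i z - g i (u (k j))| < j.+1%:R^-1.
  by case: j => // j ij; have [_] := hnxt ((k j).+1, j.+1); exact.
exists k => //; exists z => //; apply/weak_cvg_seqP => f fb.
apply: contrapT => nfz.
have [e e0 far] : exists2 e, 0 < e &
    forall N, exists n, (N <= n)%N /\ e <= `|f z - f (u (k n))|.
  apply: contrapT => nfar; apply: nfz; apply/cvgrPdist_lt => e e0.
  apply: contrapT => nnear; apply: nfar; exists e => // N.
  apply: contrapT => nN; apply: nnear; exists N => // n /= Nn.
  by rewrite ltNge; apply/negP => le_e; apply: nN; exists n.
have /choice[psi hpsi] := far.
have [|z' Kz' clz'] := clusterK (u \o k \o psi); first by move=> n; exact: Ku.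
have near_z' h r : ball1 h -> 0 < r -> nbhs (z' : weak E) [set y | `|h z' - h y| < r].
  move=> hb r0; have /cvgrPdist_lt := dual_ball_weak_continuous hb (x := z').
  exact.
have zz' : z = z'.
  apply: separating => // i; apply/eqP; rewrite -subr_eq0 -normr_le0.
  apply/ler_addgt0Pl => r r0.
  have r20 : 0 < r / 2 by rewrite divr_gt0.
  have [p _ /(_ _ (leqnn p)) /= hp] := near_infty_natSinv_lt (PosNum r20).
  have [n hn /= h1] := clz' _ (near_z' (g i) _ (gb i) r20) (maxn i.+1 p).
  have [nn _] := hpsi n.
  have h2 := k_near i (psi n) (leq_trans (leq_trans (leq_maxl _ _) hn) nn).
  have h3 : (psi n).+1%:R^-1 <= p.+1%:R^-1 :> R.
    rewrite lef_pV2 ?posrE// ler_nat ltnS.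
    exact: leq_trans (leq_trans (leq_maxr _ _) hn) nn.
  have h4 := lt_trans (lt_le_trans h2 h3) hp.
  move: h1 h4; rewrite !ltr_norml !ler_norml; lra.
have [n _ /=] := clz' _ (near_z' f _ fb e0) 0%N.
by rewrite -zz' ltNge; have [_ ->] := hpsi n.
Qed.

End SequentialCompactness.

(** * Kakutani's fixed point theorem *)

Section FixedPoint.
Variables (R : realType) (E : normedModType R).
Local Notation ball1 := (@dual_ball R E).

Lemma convex_sum (X : set E) (I : finType) (p : I -> R) (v : I -> E) :
  closed X -> convex_lmod X -> simplex p -> (forall i, X (v i)) ->
  X (\sum_i p i *: v i).
Proof.
move=> Xc Xconv [p0 p1] Xv; apply: contrapT => nX.
have [i] : exists i : I, True.
  apply: contrapT => nI; move: p1; rewrite big1 => [/eqP|i _].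
    by rewrite eq_sym oner_eq0.
  by exfalso; apply: nI; exists i.
have X0 : X !=set0 by exists (v i).
have [f [dl [fb dl0 hf]]] := closed_convex_separation Xc Xconv X0 nX.
suff : f (\sum_i p i *: v i) + dl <= f (\sum_i p i *: v i) by lra.
rewrite -[X in X <= _]mul1r -{1}p1 mulr_suml [leRHS](scalar_form_sum fb.1).
by apply: ler_sum => j _; rewrite ler_wpM2l// hf.
Qed.

Lemma finite_net (X : set E) (M : R) (d : nat -> E) (m : nat)
    (g : nat -> E -> R) (eta : R) :
  X `<=` closure (range d) -> (forall x, X x -> `|x| <= M) ->
  (forall n, X (d n)) -> (forall j, ball1 (g j)) -> 0 < eta ->
  exists (I : finType) (i0 : I) (w : I -> nat), forall x, X x ->
    exists i, forall j, (j < m)%N -> `|g j x - g j (d (w i))| <= eta.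
Proof.
move=> Xd XM dX gb eta0.
pose L := Num.truncn ((M + M) / (eta / 2)).
pose cell x : {ffun 'I_m -> 'I_L.+1} :=
  [ffun j : 'I_m => inord (Num.truncn ((g j x + M) / (eta / 2)))].
have /choice[w hw] : forall c, exists n, (exists n', cell (d n') = c) ->
    cell (d n) = c.
  move=> c; have [[n hn]|nc] := pselect (exists n', cell (d n') = c).
    by exists n.
  by exists 0%N => /nc.
exists {ffun 'I_m -> 'I_L.+1}, [ffun=> ord0], w => x Xx.
have eta20 : 0 < eta / 2 by rewrite divr_gt0.
have [_ [[n _ <-]]] := Xd _ Xx _ (nbhsx_ballx x _ eta20).
rewrite -ball_normE /ball_/= => xn; exists (cell (d n)) => j jm.
have same : cell (d (w (cell (d n)))) = cell (d n) by apply: hw; exists n.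
set n' := w _ in same *.
have bnd k : 0 <= (g j (d k) + M) / (eta / 2) <= (M + M) / (eta / 2).
  have := (gb j).2 (d k); have := XM _ (dX k) => h1 h2.
  have := le_trans h2 h1; rewrite ler_norml => /andP[h3 h4].
  rewrite divr_ge0 ?(ltW eta20)//=; last by lra.
  by rewrite ler_pM2r ?invr_gt0// lerD2r.
have tr : Num.truncn ((g j (d n') + M) / (eta / 2)) =
    Num.truncn ((g j (d n) + M) / (eta / 2)).
  move/ffunP/(_ (Ordinal jm)): same; rewrite !ffunE => /(congr1 val) /=.
  by rewrite !inordK// ltnS; apply: le_truncn; case/andP: (bnd n); case/andP: (bnd n').
have [/truncn_itv t1 /truncn_itv t2] : 0 <= (g j (d n) + M) / (eta / 2) /\
    0 <= (g j (d n') + M) / (eta / 2).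
  by split; [case/andP: (bnd n)|case/andP: (bnd n')].
have h1 := (gb j).2 (x - d n); rewrite (scalar_formB (gb j).1) in h1.
have h2 := le_lt_trans h1 xn.
have h3 : `|g j (d n) - g j (d n')| <= eta / 2.
  have : `|(g j (d n) + M) / (eta / 2) - (g j (d n') + M) / (eta / 2)| <= 1.
    rewrite tr in t2; move: t1 t2; rewrite -natr1 ler_norml; lra.
  rewrite -mulrBl normrM [X in _ * X]ger0_norm ?invr_ge0 ?(ltW eta20)//.
  rewrite ler_pdivrMr// mul1r; congr (`|_| <= _); lra.
rewrite -[_ - _](subrKA (g j (d n))) (le_trans (ler_normD _ _))//.
lra.
Qed.

Lemma lipschitz_partition (I : finType) (s : I -> E -> R) (Ls e : R) :
  0 < e -> 0 <= Ls -> (forall i x y, s i x - s i y <= Ls * `|x - y|) ->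
  exists p : I -> E -> R, [/\
    forall x, (exists i, s i x <= e / 2) -> simplex (p ^~ x),
    forall i x, 0 < p i x -> s i x <= e &
    forall i x y, (exists i, s i x <= e / 2) -> (exists i, s i y <= e / 2) ->
      `|p i x - p i y| <= 2 * (1 + #|I|%:R) * Ls / e * `|x - y|].
Proof.
move=> e0 Ls0 sL.
pose q i x := Num.max 0 (e - s i x).
pose Q x := \sum_i q i x.
have q0 i x : 0 <= q i x by rewrite /q le_max lexx.
have Q0 x : (exists i, s i x <= e / 2) -> e / 2 <= Q x.
  move=> [i si]; rewrite /Q (bigD1 i)//=.
  apply: (@le_trans _ _ (q i x)); first by rewrite /q le_max; apply/orP; right; lra.
  by rewrite lerDl sumr_ge0.
have qL i x y : q i x - q i y <= Ls * `|x - y|.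
  rewrite lerBlDr {1}/q ge_max; apply/andP; split.
    by rewrite addr_ge0// mulr_ge0.
  have : e - s i y <= q i y by rewrite /q le_max lexx orbT.
  have := sL i y x; rewrite distrC; lra.
have QL x y : Q x - Q y <= #|I|%:R * (Ls * `|x - y|).
  rewrite /Q -sumrB mulr_natl -sumr_const; apply: ler_sum => i _; exact: qL.
exists (fun i x => q i x / Q x); split.
- move=> x /Q0 Qx; have Qx0 : 0 < Q x by lra.
  split=> [i|]; first by rewrite divr_ge0// ltW.
  by rewrite -mulr_suml divff// gt_eqF.
- move=> i x; apply: contraTT; rewrite -!ltNge -leNgt => se.
  by rewrite /q max_l ?mul0r//; lra.
have one i x y : (exists i, s i x <= e / 2) -> (exists i, s i y <= e / 2) ->
    q i x / Q x - q i y / Q y <= 2 * (1 + #|I|%:R) * Ls / e * `|x - y|.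
  move=> /Q0 Qx /Q0 Qy.
  have Qx0 : 0 < Q x by lra.
  have Qy0 : 0 < Q y by lra.
  have -> : q i x / Q x - q i y / Q y =
      ((q i x - q i y) + q i y / Q y * (Q y - Q x)) / Q x.
    by field; rewrite !gt_eqF.
  have B0 : 0 <= Ls * `|x - y| by rewrite mulr_ge0.
  have py : 0 <= q i y / Q y <= 1.
    rewrite divr_ge0 ?(ltW Qy0)//= ler_pdivrMr// mul1r /Q (bigD1 i)//=.
    by rewrite lerDl sumr_ge0.
  have h : (q i x - q i y) + q i y / Q y * (Q y - Q x) <=
      (1 + #|I|%:R) * (Ls * `|x - y|).
    have h1 := qL i x y; have := QL y x; rewrite distrC => h2.
    have N0 : 0 <= #|I|%:R * (Ls * `|x - y|) by rewrite mulr_ge0.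
    move/andP: py => [p0 p1].
    have h3 := ler_wpM2l p0 h2.
    have h4 := ler_wpM2r N0 p1.
    lra.
  rewrite ler_pdivrMr//; apply: le_trans h _.
  have C0 : 0 <= (1 + #|I|%:R) * (Ls * `|x - y|) by rewrite mulr_ge0// addr_ge0.
  have -> : 2 * (1 + #|I|%:R) * Ls / e * `|x - y| * Q x =
     (1 + #|I|%:R) * (Ls * `|x - y|) * (Q x / (e / 2)).
    by field; rewrite gt_eqF.
  by rewrite ler_peMr// ler_pdivlMr ?divr_gt0// mul1r.
move=> i x y gx gy; rewrite ler_norml lerNl opprB one// andbT.
by rewrite distrC one.
Qed.

(* Schauder projection onto the hull of the images of a finite net, composed
   with the approximate Brouwer theorem. *)
Lemma schauder_step (X : set E) (M : R) (d : nat -> E) (t : E -> E) (m : nat)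
    (g : nat -> E -> R) (e : R) :
  closed X -> convex_lmod X -> X `<=` closure (range d) ->
  (forall x, X x -> `|x| <= M) -> (forall n, X (d n)) ->
  (forall n, X (t (d n))) -> (forall j, ball1 (g j)) -> 0 < e ->
  exists2 x, X x & forall f, ball1 f -> exists n,
    (forall j, (j < m)%N -> `|g j x - g j (d n)| <= e) /\ f (t (d n)) <= f x + e.
Proof.
move=> Xc Xconv Xd XM dX tX gb e0.
have eta0 : 0 < e / 2 / m.+1%:R by rewrite !divr_gt0.
have [I0 [i0 [w0 net0]]] := finite_net m Xd XM dX gb eta0.
pose I : finType := (I0 * bool)%type; pose w (i : I) := w0 i.1.
pose s (i : I) x := \sum_(j < m) `|g j x - g j (d (w i))|.
have sL i x y : s i x - s i y <= m%:R * `|x - y|.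
  rewrite /s -sumrB -[in leRHS](card_ord m) mulr_natl -sumr_const.
  apply: ler_sum => j _.
  have h1 := ler_normD (g j x - g j y) (g j y - g j (d (w i))).
  rewrite subrKA in h1.
  have h2 := (gb j).2 (x - y); rewrite (scalar_formB (gb j).1) in h2.
  lra.
have m0 : 0 <= m%:R :> R by [].
have [p [p_simplex p_supp pL]] := lipschitz_partition e0 m0 sL.
have net x : X x -> exists i, s i x <= e / 2.
  move=> Xx; have [i hi] := net0 _ Xx; exists (i, false).
  apply: (@le_trans _ _ (\sum_(j < m) e / 2 / m.+1%:R)).
    by apply: ler_sum => j _; apply: hi.
  rewrite sumr_const card_ord -[leLHS]mulr_natl mulrCA ger_pMr ?divr_gt0//.
  by rewrite ler_pdivrMr// mul1r ler_nat.
pose h (a : I -> R) := \sum_i a i *: t (d (w i)).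
have hX a : simplex a -> X (h a) by move=> sa; apply: convex_sum => // i.
have M0 : 0 <= M by apply: le_trans (XM _ (dX 0%N)).
have hL a b : `|h a - h b| <= M * \sum_i `|a i - b i|.
  rewrite /h -sumrB mulr_sumr; apply: le_trans (ler_norm_sum _ _ _) _.
  apply: ler_sum => i _; rewrite -scalerBl normrZ mulrC ler_wpM2r//.
  exact: XM.
pose L := 2 * (1 + #|I|%:R) * m%:R / e * M.
have K0 : 0 <= 2 * (1 + #|I|%:R) * m%:R / e :> R.
  by rewrite divr_ge0 ?(ltW e0)// !mulr_ge0// addr_ge0.
have eps0 : 0 < e / (M * #|I|%:R + 1).
  by rewrite divr_gt0// ltr_wpDl// mulr_ge0.
have i10 : (i0, true) != (i0, false) :> I by apply/eqP => -[].
have [|a b i sa sb|a sa ha] := @brouwer_approx R I _ _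
    (fun a i => p i (h a)) L i10 _ _ _ eps0.
- by move=> a sa; exact/p_simplex/net/hX.
- apply: (le_trans (pL i _ _ (net _ (hX _ sa)) (net _ (hX _ sb)))).
  by rewrite /L -[leRHS]mulrA ler_wpM2l.
exists (h a); first exact: hX.
move=> f fb; have px := p_simplex _ (net _ (hX _ sa)).
pose x := h a; pose x' := \sum_i p i x *: t (d (w i)).
have xx' : `|x - x'| <= e.
  apply: le_trans (hL a (p ^~ x)) _.
  apply: (@le_trans _ _ (M * (#|I|%:R * (e / (M * #|I|%:R + 1))))).
    rewrite ler_wpM2l// mulr_natl -sumr_const; apply: ler_sum => i _.
    by rewrite distrC ha.
  have c0 : 0 <= M * #|I|%:R by rewrite mulr_ge0.
  rewrite mulrA mulrA ler_pdivrMr; last by rewrite ltr_wpDl.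
  lra.
have fx' : f x' <= f x + e.
  have := fb.2 (x - x'); rewrite (scalar_formB fb.1).
  move=> /le_trans/(_ xx'); rewrite ler_norml; lra.
have [i pi0 fi] : exists2 i, 0 < p i x & f (t (d (w i))) <= f x'.
  apply: contrapT => ni; have [pge0 psum] := px.
  have fE : f x' = \sum_i p i x * f (t (d (w i))) by exact: (scalar_form_sum fb.1).
  have [i pi0] : exists i, 0 < p i x.
    apply: contrapT => nopos; suff : \sum_i p i x <= 0 by rewrite psum ler10.
    apply: sumr_le0 => i _; rewrite leNgt; apply/negP => pi0; apply: nopos.
    by exists i.
  have gt_i j : 0 < p j x -> f x' < f (t (d (w j))).
    by move=> pj; rewrite ltNge; apply/negP => le_j; apply: ni; exists j.
  suff : f x' < \sum_i p i x * f (t (d (w i))) by rewrite -fE ltxx.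
  rewrite -[ltLHS]mul1r -psum mulr_suml (bigD1 i)//= [ltRHS](bigD1 i)//=.
  apply: ltr_leD; first by rewrite ltr_pM2l// gt_i.
  apply: ler_sum => j _; have := pge0 j; rewrite le_eqVlt => /orP[/eqP <-|pj].
    by rewrite !mul0r.
  by rewrite ler_wpM2l ?(ltW pj)// ltW// gt_i.
exists (w i); split; last exact: le_trans fi fx'.
move=> j jm; apply: le_trans (p_supp _ _ pi0).
by rewrite /s (bigD1 (Ordinal jm))//= lerDl sumr_ge0.
Qed.

End FixedPoint.

Section Kakutani.
Variables (R : realType) (E : normedModType R).
Local Notation ball1 := (@dual_ball R E).

Lemma subseq_cvg (k : nat -> nat) : {homo k : m n / (m < n)%N} -> k @ \oo --> \oo.
Proof.
move=> k_incr; have kn n : (n <= k n)%N.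
  by elim: n => // n IH; apply: leq_ltn_trans IH (k_incr _ _ (ltnSn n)).
by move=> A [N _ NA]; exists N => // n /= Nn; apply: NA; apply: leq_trans (kn n).
Qed.

Lemma weak_cvg_subseq (u : nat -> E) (l : E) (k : nat -> nat) :
  {homo k : m n / (m < n)%N} -> weak_cvg u l -> weak_cvg (u \o k) l.
Proof.
move=> k_incr /weak_cvg_seqP ul; apply/weak_cvg_seqP => f fb.
exact: (cvg_comp _ _ (subseq_cvg k_incr) (ul f fb)).
Qed.

Lemma kakutani (X : set E) (M : R) (d : nat -> E) (t : E -> E) (G : E -> set E) :
  weakly_compact X -> closed X -> convex_lmod X -> X `<=` closure (range d) ->
  (forall x, X x -> `|x| <= M) -> (forall n, X (d n)) ->
  (forall n, X (t (d n))) ->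
  (forall x, X x -> closed (G x) /\ convex_lmod (G x)) ->
  (forall (n_ : nat -> nat) x y, X x -> weak_cvg (d \o n_) x ->
    weak_cvg (t \o d \o n_) y -> G x y) ->
  exists2 x, X x & G x x.
Proof.
move=> Xw Xc Xconv Xd XM dX tX Gval Ggraph.
have [g [gb gsep]] := separating_sequence Xd.
pose e n : R := n.+1%:R^-1.
have e0 n : 0 < e n by rewrite invr_gt0.
have /choice[x_ hx] : forall m, exists x, X x /\ forall f, ball1 f -> exists n,
    (forall j, (j < m)%N -> `|g j x - g j (d n)| <= e m) /\
    f (t (d n)) <= f x + e m.
  move=> m; have [x Xx hx] := schauder_step m Xc Xconv Xd XM dX tX gb (e0 m).
  by exists x.
have [k k_incr [x Xx xk]] := weakly_seq_compact Xw Xd (fun m => (hx m).1).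
exists x => //; apply: contrapT => nG.
have [Gc Gconv] := Gval _ Xx.
have [f [dl [fb dl0 hf]]] : exists f dl, [/\ ball1 f, 0 < dl &
    forall c, G x c -> f x + dl <= f c].
  have [G0|G0] := pselect (G x !=set0); first exact: closed_convex_separation.
  exists (fun=> 0), 1; split => //; first exact: dual_ball0.
  by move=> c Gxc; exfalso; apply: G0; exists c.
have /choice[n_ hn] := fun m => (hx m).2 f fb.
have [k' k'_incr [x' Xx' x'k]] := weakly_seq_compact Xw Xd (fun m => dX (n_ (k m))).
have [k'' k''_incr [y Xy yk]] :=
  weakly_seq_compact Xw Xd (fun m => tX (n_ (k (k' m)))).
pose kap := k \o k' \o k''.
have kap_incr : {homo kap : m n / (m < n)%N} by move=> m n /k''_incr/k'_incr/k_incr.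
have xkap : weak_cvg (x_ \o kap) x.
  exact: (weak_cvg_subseq k''_incr (weak_cvg_subseq k'_incr xk)).
have x'kap : weak_cvg (d \o (n_ \o kap)) x' := weak_cvg_subseq k''_incr x'k.
have ekap : (e \o kap) @ \oo --> (0 : R).
  by apply: (cvg_comp _ _ (subseq_cvg kap_incr)); exact: cvg_harmonic.
have xx' : x = x'.
  apply: gsep => // j; apply/eqP; rewrite -subr_eq0; apply/eqP.
  have h1 : (g j (x_ (kap i)) - g j (d (n_ (kap i)))) @[i --> \oo] --> g j x - g j x'.
    apply: cvgB; first exact: (iffLR (weak_cvg_seqP _ _) xkap _ (gb j)).
    exact: (iffLR (weak_cvg_seqP _ _) x'kap _ (gb j)).
  apply: (cvg_unique _ h1); first exact: norm_hausdorff.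
  apply: norm_cvg0; apply: (squeeze_cvgr _ (cvg_cst 0) ekap).
  near=> i; rewrite normr_ge0/=.
  have kj : (j < kap i)%N.
    by near: i; exact: (subseq_cvg kap_incr (nbhs_infty_gt j)).
  by have [/(_ j kj)] := hn (kap i).
have Gxy : G x y by apply: (Ggraph (n_ \o kap)) => //; rewrite xx'.
have : f y <= f x.
  have h1 : (f (x_ (kap i)) + e (kap i)) @[i --> \oo] --> f x + 0.
    apply: cvgD => //; exact: (iffLR (weak_cvg_seqP _ _) xkap _ fb).
  rewrite addr0 in h1.
  apply: (ler_cvg_to (iffLR (weak_cvg_seqP _ _) yk _ fb) h1).
  by near=> i; have [_] := hn (kap i).
have := hf _ Gxy; lra.
Unshelve. all: by end_near. Qed.

End Kakutani.

(** * Measure of weak noncompactness *)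

Section DeBlasi.
Variables (R : realType) (E : normedModType R).
Implicit Types (W K : set E).
Local Notation ball1 := (@dual_ball R E).

Definition de_blasi_radius W : set R := [set e | 0 < e /\
  exists2 K, weakly_compact K & forall x, W x -> exists2 k, K k & `|x - k| <= e].

Lemma de_blasiE W : de_blasi W = inf (de_blasi_radius W).
Proof.
congr inf; apply/seteqP; split => e [e0 [K Kc WK]]; split => //; exists K => // x Wx.
  have [k Kk [b]] := WK _ Wx; rewrite closed_ballE// /closed_ball_/= sub0r normrN.
  by move=> be <-; exists k => //; rewrite addrAC subrr add0r.
have [k Kk xk] := WK _ Wx; exists k => //; exists (x - k).
  by rewrite closed_ballE// /closed_ball_/= sub0r normrN.
by rewrite addrC subrK.
Qed.

Lemma de_blasi_radius_lb W : has_lbound (de_blasi_radius W).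
Proof. by exists 0 => e [/ltW]. Qed.

Lemma de_blasi_le W e : de_blasi_radius W e -> de_blasi W <= e.
Proof. by rewrite de_blasiE; apply: ge_inf; exact: de_blasi_radius_lb. Qed.

Lemma weakly_compact_set1 (x : E) : weakly_compact [set x].
Proof. exact: compact_set1. Qed.

Lemma de_blasi_radius_bounded W M : 0 < M -> (forall x, W x -> `|x| <= M) ->
  de_blasi_radius W M.
Proof.
move=> M0 WM; split => //; exists [set 0]; first exact: weakly_compact_set1.
by move=> x /WM xM; exists 0 => //; rewrite subr0.
Qed.

Lemma de_blasi_ge0 W : de_blasi_radius W !=set0 -> 0 <= de_blasi W.
Proof. by move=> W0; rewrite de_blasiE; apply: lb_le_inf => // e [/ltW]. Qed.

Lemma de_blasi_lt W e : de_blasi_radius W !=set0 -> de_blasi W < e ->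
  exists2 e', de_blasi_radius W e' & e' < e.
Proof.
rewrite de_blasiE => W0 We; have inf_W : has_inf (de_blasi_radius W).
  by split => //; exact: de_blasi_radius_lb.
have e0 : 0 < e - inf (de_blasi_radius W) by lra.
have [e' We' he'] := inf_adherent e0 inf_W.
by exists e' => //; lra.
Qed.

Lemma weak_affine_continuous (c : R) (v : E) :
  continuous ((fun x => c *: x + v) : weak E -> weak E).
Proof.
move=> x; have FF := @nbhs_filter (weak E) x.
apply/weak_cvgP => f fb.
have -> : f (c *: x + v) = c * f x + f v by rewrite fb.1.
have h : (fun y => c * f y + f v) @ nbhs (x : weak E) --> c * f x + f v.
  apply: cvgD; last exact: cvg_cst.
  by apply: cvgMr; exact: (dual_ball_weak_continuous fb (x := x)).
have E1 : (fun y => c * f y + f v) = f \o (fun y => c *: y + v).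
  by apply/funext => y /=; rewrite fb.1.
by rewrite E1 in h.
Qed.

Lemma weakly_compact_affine K (c : R) (v : E) : weakly_compact K ->
  weakly_compact [set c *: k + v | k in K].
Proof.
move=> Kc; apply: (@continuous_compact (weak E) (weak E)) => //.
by apply: continuous_subspaceT; exact: weak_affine_continuous.
Qed.

Lemma weak_cvg_affine (u : nat -> E) (l : E) (c : R) (v : E) :
  weak_cvg u l -> weak_cvg (fun n => c *: u n + v) (c *: l + v).
Proof.
by move=> ul; exact: (cvg_comp _ _ ul (@weak_affine_continuous c v l)).
Qed.

Lemma weak_cvgD (u v : nat -> E) (l m : E) :
  weak_cvg u l -> weak_cvg v m -> weak_cvg (fun n => u n + v n) (l + m).
Proof.
move=> /weak_cvg_seqP ul /weak_cvg_seqP vm; apply/weak_cvg_seqP => f fb.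
rewrite scalar_formD; last exact: fb.1.
under eq_fun do rewrite (scalar_formD fb.1).
by apply: cvgD; [exact: ul|exact: vm].
Qed.

Lemma norm_weak_cvg0 (u : nat -> E) (e_ : nat -> R) :
  (forall n, `|u n| <= e_ n) -> e_ @ \oo --> (0 : R) -> weak_cvg u 0.
Proof.
move=> ue e0; apply/weak_cvg_seqP => f fb; rewrite scalar_form0; last exact: fb.1.
apply: norm_cvg0; apply: (squeeze_cvgr _ (cvg_cst 0) e0).
by apply: nearW => n; rewrite normr_ge0 (le_trans (fb.2 _)).
Qed.

End DeBlasi.

Section HullIter.
Variables (R : realType) (E : normedModType R) (S : set E) (T : E -> set E).
Hypothesis S_neq0 : S !=set0.
Hypothesis S_closed : closed S.
Hypothesis S_convex : convex_set S.
Hypothesis T_multimap : multimap_on S T.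

Lemma closed_convex_hull_closed (A : set E) : closed (closed_convex_hull A).
Proof. by apply: closed_bigI => C [[]]. Qed.

Lemma closed_convex_hull_convex (A : set E) : convex_lmod (closed_convex_hull A).
Proof.
move=> x y t Ax Ay t01 C [[Cc Cconv] AC].
move/convex_lmodP: (Cconv); apply => //; [exact: Ax|exact: Ay].
Qed.

Lemma hull_iterP n : [/\ closed (hull_iter S T n), convex_lmod (hull_iter S T n),
  hull_iter S T n !=set0, hull_iter S T n `<=` S &
  mimage T (hull_iter S T n) `<=` hull_iter S T n].
Proof.
elim: n => [|n [c1 c2 [x Hx] sub img]].
  split => //; first exact/convex_lmodP.
  by move=> y [x Sx]; exact: (T_multimap Sx).2.
have sub1 : hull_iter S T n.+1 `<=` hull_iter S T n.
  apply: smallest_sub => //; split => //; exact/convex_lmodP.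
have img1 : mimage T (hull_iter S T n) `<=` hull_iter S T n.+1.
  exact: sub_smallest.
split.
- exact: closed_convex_hull_closed.
- exact: closed_convex_hull_convex.
- have [y Txy] := (T_multimap (sub _ Hx)).1.
  by exists y; apply: img1; exists x.
- exact: subset_trans sub.
- by move=> y [z /sub1 Hz Tzy]; apply: img1; exists z.
Qed.

End HullIter.

(** * Fixed points of the contractions *)

Lemma convex_lmod_mid (R : realType) (V : lmodType R) (C : set V) x y :
  convex_lmod C -> C x -> C y -> C (2^-1 *: (x + y)).
Proof.
move=> Cconv Cx Cy; have t01 : 0 <= (2^-1 : R) <= 1 by lra.
have := Cconv _ _ _ Cx Cy t01; rewrite scalerDr; congr (C (_ + _ *: _)); lra.
Qed.

Lemma closure_sub_closed (T : topologicalType) (A B : set T) :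
  closed B -> A `<=` B -> closure A `<=` B.
Proof.
move=> Bc AB x Ax; apply: Bc => U /Ax[y [/AB By Uy]].
by exists y.
Qed.

Section Generated.
Variables (R : realType) (E : completeNormedModType R).
Variables (a : nat -> E) (t : E -> E).
Local Notation D := (generated a t).

Lemma generated_sub (C : set E) : convex_lmod C -> (forall n, C (a n)) ->
  (forall x, C x -> C (t x)) -> D `<=` C.
Proof.
move=> Cconv Ca Ct x; elim=> [n|y _|y z _ Cy _ Cz] //; first exact: Ct.
exact: convex_lmod_mid.
Qed.

Lemma generated_closure_convex : convex_lmod (closure D).
Proof.
apply: closed_midpoint_convex; first exact: closed_closure.
by apply: closure_midpoint_closed => x y; exact: generated_mid.
Qed.

End Generated.

Lemma weakly_compact_convex_hull (R : realType) (E : completeNormedModType R)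
    (K : set E) (M : R) (a : nat -> E) :
  weakly_compact K -> (forall n, K (a n)) -> (forall n, `|a n| <= M) ->
  weakly_compact (closure (generated a id)).
Proof.
move=> Kc Ka aM; have [d dE] := generated_enum a id.
apply: (weakly_compact_hull (d := d) Kc Ka _ aM).
- by move=> n; apply: subset_closure; exact: generated_base.
- exact: closed_closure.
- exact: generated_closure_convex.
- by rewrite dE.
- move=> f c fb fa x Dx; apply/ler_addgt0Pr => e e0.
  have [y [Dy]] := Dx _ (nbhsx_ballx x _ e0).
  rewrite -ball_normE /ball_/= => xy.
  have fy : f y <= c.
    have Cconv : convex_lmod [set z | f z <= c].
      move=> u v s /= fu fv /andP[s0 s1]; rewrite fb.1 (scalar_formZ fb.1).
      have := ler_wpM2l s0 fu; have : 0 <= 1 - s by lra.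
      move=> /ler_wpM2l/(_ _ _ fv); lra.
    exact: (generated_sub Cconv fa (fun _ h => h) Dy).
  have := fb.2 (x - y); rewrite (scalar_formB fb.1) => /le_lt_trans/(_ xy).
  rewrite ltr_norml; lra.
Qed.

Section Contraction.
Variables (R : realType) (E : completeNormedModType R).
Variables (S : set E) (T : E -> set E) (Omega : set E) (phi : R -> R).
Hypothesis T_graph : weakly_seq_closed_graph S T.
Hypothesis Omega_closed : closed Omega.
Hypothesis Omega_convex : convex_lmod Omega.
Hypothesis Omega_S : Omega `<=` S.
Hypothesis T_neq0 : forall x, Omega x -> T x !=set0.
Hypothesis T_Omega : mimage T Omega `<=` Omega.
Variable M : R.
Hypothesis M_gt0 : 0 < M.
Hypothesis Omega_M : forall x, Omega x -> `|x| <= M.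
Hypothesis T_values : forall x, Omega x -> closed (T x) /\ convex_set (T x).
Hypothesis T_Lipschitz : countably_D_set_Lipschitzian Omega T phi.
Hypothesis phi_le : forall r, 0 < r -> r <= set_norm Omega -> phi r <= r.

Lemma bounded_Omega (W : set E) : W `<=` Omega -> bounded_set W.
Proof.
move=> WO; apply: filterS (nbhs_pinfty_ge (num_real M)) => r Mr x Wx.
exact: le_trans (Omega_M (WO _ Wx)) Mr.
Qed.

Lemma de_blasi_le_set_norm (W : set E) : W !=set0 -> W `<=` Omega ->
  de_blasi W <= set_norm Omega.
Proof.
move=> [w Ww] WO; apply/ler_addgt0Pr => e e0.
have Onorm x : Omega x -> `|x| <= set_norm Omega.
  move=> Ox; apply: ub_le_sup; last by exists x.
  by exists M => _ [y Oy <-]; exact: Omega_M.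
apply: de_blasi_le; apply: de_blasi_radius_bounded.
  by rewrite ltr_wpDl// (le_trans _ (Onorm _ (WO _ Ww))).
by move=> x Wx; rewrite (le_trans (Onorm _ (WO _ Wx)))// lerDl ltW.
Qed.

Variables (x0 : E) (lam : R).
Hypothesis Omega_x0 : Omega x0.
Hypothesis lam01 : 0 < lam < 1.

Section Selection.
Variable t : E -> E.
Hypothesis tT : forall x, Omega x -> T x (t x).

Let v := (1 - lam) *: x0.
Let D := generated (fun=> x0) (fun x => lam *: t x + v).

Lemma contraction_sub : D `<=` Omega.
Proof.
have /andP[l0 l1] := lam01; apply: generated_sub => // x Ox.
apply: Omega_convex => //; last by rewrite !ltW.
by apply: T_Omega; exists x => //; exact: tT.
Qed.

Lemma image_Omega x : Omega x -> Omega (t x).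
Proof. by move=> Ox; apply: T_Omega; exists x => //; exact: tT. Qed.

Lemma de_blasi_contraction (d : nat -> E) : range d = D ->
  de_blasi D = 0.
Proof.
move=> dE; have /andP[l0 l1] := lam01; set b := de_blasi D.
have radD : de_blasi_radius D M.
  by apply: de_blasi_radius_bounded => // x /contraction_sub; exact: Omega_M.
have b0 : 0 <= b by apply: de_blasi_ge0; exists M.
apply/eqP; rewrite eq_le b0 andbT leNgt; apply/negP => bpos.
have TD : mimage T D `<=` Omega.
  by move=> y [x /contraction_sub Ox Txy]; apply: T_Omega; exists x.
have Dd n : D (d n) by rewrite -dE; exists n.
have beta_le : de_blasi (mimage T D) <= b.
  have [_ /(_ D)] := T_Lipschitz.
  have cD : countable D by rewrite -dE; exact: (sub_countable (card_image_le _ _)).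
  move=> /(_ cD contraction_sub (bounded_Omega contraction_sub) (bounded_Omega TD)).
  move=> /le_trans; apply; apply: phi_le => //.
  by apply: de_blasi_le_set_norm contraction_sub; exists (d 0%N).
have radTD : de_blasi_radius (mimage T D) M.
  by apply: de_blasi_radius_bounded => // x /TD; exact: Omega_M.
have [e [e0 [K Kc TK]] eb] : exists2 e, de_blasi_radius (mimage T D) e & e < b / lam.
  apply: de_blasi_lt; first by exists M.
  by apply: le_lt_trans beta_le _; rewrite ltr_pdivlMr// gtr_pMr.
have /choice[kappa hk] : forall n, exists k, K k /\ `|t (d n) - k| <= e.
  move=> n; have [|k Kk tk] := TK (t (d n)); last by exists k.
  by exists (d n) => //; apply: tT; exact: contraction_sub.
pose a n := if n is m.+1 then kappa m else x0.
pose X := closure (generated a id).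
have Xconv : convex_lmod X by exact: generated_closure_convex.
have Xa n : X (a n) by apply: subset_closure; exact: generated_base.
have Xw : weakly_compact X.
  apply: (@weakly_compact_convex_hull _ _ (K `|` [set x0]) (M + e)).
  - by apply: compactU; [exact: Kc|exact: compact_set1].
  - by case=> [|n] /=; [right|left; have [] := hk n].
  - case=> [|n] /=; first by rewrite (le_trans (Omega_M Omega_x0))// lerDl ltW.
    have [_ tk] := hk n.
    rewrite -[kappa n](subrK (t (d n))) addrC (le_trans (ler_normD _ _))//.
    by rewrite lerD 1?distrC// Omega_M//; apply/image_Omega/contraction_sub.
suff : de_blasi_radius D (lam * e).
  move=> /de_blasi_le; rewrite -/b leNgt => /negP; apply.
  by rewrite mulrC -ltr_pdivlMr.
split; first by rewrite mulr_gt0.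
exists [set lam *: k + v | k in X]; first exact: weakly_compact_affine.
move=> x Dx.
suff [k Xk xk] : exists2 k, X k & `|x - (lam *: k + v)| <= lam * e.
  by exists (lam *: k + v) => //; exists k.
elim: Dx => [_|y Dy _|y z _ [k Xk yk] _ [l Xl zl]].
- exists x0; first exact: (Xa 0%N).
  rewrite /v -scalerDl [lam + _]addrC subrK scale1r subrr normr0.
  by rewrite mulr_ge0 ?ltW.
- have [n _ dn] : range d y by rewrite dE.
  exists (kappa n); first exact: (Xa n.+1).
  rewrite opprD addrACA subrr addr0 -scalerBr normrZ gtr0_norm//.
  by rewrite ler_wpM2l ?(ltW l0)// -dn; have [] := hk n.
- exists (2^-1 *: (k + l)); first exact: (convex_lmod_mid Xconv Xk Xl).
  have -> : 2^-1 *: (y + z) - (lam *: (2^-1 *: (k + l)) + v) =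
      2^-1 *: ((y - (lam *: k + v)) + (z - (lam *: l + v))).
    rewrite addrACA -opprD scalerBr; congr (_ - _).
    rewrite addrACA -scalerDr [RHS]scalerDr !scalerA [lam * _]mulrC; congr (_ + _).
    by rewrite scalerDr -scalerDl (_ : _ + _ = 1 :> R) ?scale1r//; lra.
  rewrite normrZ ger0_norm ?invr_ge0//.
  have := ler_normD (y - (lam *: k + v)) (z - (lam *: l + v)).
  lra.
Qed.

Lemma weakly_compact_contraction (d : nat -> E) : range d = D ->
  weakly_compact (closure D).
Proof.
move=> dE; have b0 := de_blasi_contraction dE.
have radD : de_blasi_radius D M.
  by apply: de_blasi_radius_bounded => // x /contraction_sub; exact: Omega_M.
apply: (@weakly_compact_approx _ _ _ M).
- exact: closed_closure.
- exact: generated_closure_convex.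
- move=> x Dx; apply: Omega_M; move: x Dx.
  by apply: closure_sub_closed => //; exact: contraction_sub.
move=> e e0; have e20 : 0 < e / 2 by rewrite divr_gt0.
have [||e' [e'0 [K Kc DK]] he'] := @de_blasi_lt _ _ D (e / 2).
- by exists M.
- by rewrite b0.
exists K => // x Dx; have [y [Dy]] := Dx _ (nbhsx_ballx x _ e20).
rewrite -ball_normE /ball_/= => xy; have [k Kk yk] := DK _ Dy; exists k => //.
rewrite -(subrKA y) (le_trans (ler_normD _ _))//; lra.
Qed.

End Selection.

Lemma contraction_fixed_point :
  exists2 x, Omega x & exists2 y, T x y & x = lam *: y + (1 - lam) *: x0.
Proof.
have /andP[l0 l1] := lam01; have ln0 : lam != 0 by rewrite gt_eqF.
have /choice[t ht] : forall x, exists y, Omega x -> T x y.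
  move=> x; have [Ox|nOx] := pselect (Omega x); last by exists 0.
  by have [y Txy] := T_neq0 Ox; exists y.
set v := (1 - lam) *: x0; pose tl x := lam *: t x + v.
have [d dE] := generated_enum (fun=> x0) tl.
pose X := closure (generated (fun=> x0) tl).
have XO : X `<=` Omega.
  by apply: closure_sub_closed => //; exact: contraction_sub ht.
have dD n : generated (fun=> x0) tl (d n) by rewrite -dE; exists n.
pose w := - (lam^-1 *: v).
have [|||||||||x Xx Gx] := @kakutani R E X M d tl (fun x z => T x (lam^-1 *: z + w)).
- exact: weakly_compact_contraction dE.
- exact: closed_closure.
- exact: generated_closure_convex.
- by rewrite dE.
- by move=> x /XO; exact: Omega_M.
- by move=> n; exact: subset_closure.
- by move=> n; apply: subset_closure; apply: generated_map.
- move=> x /XO Ox; have [Tc /convex_lmodP Tconv] := T_values Ox; split.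
    apply: (@closed_comp _ _ (fun z => lam^-1 *: z + w)) => // z _.
    by apply: cvgD; [apply: cvgZr|exact: cvg_cst].
  move=> y z s Ty Tz s01; have := Tconv _ _ _ Ty Tz s01.
  congr (T x _); rewrite !scalerDr addrACA -scalerDl [s + _]addrC subrK scale1r.
  by rewrite !scalerA ![_ * lam^-1]mulrC.
- move=> n_ x y /XO Ox dx ty.
  apply: (T_graph (x_ := d \o n_) (y_ := t \o d \o n_)) => //.
  + by move=> n; apply: Omega_S; apply: XO; apply: subset_closure; exact: dD.
  + exact: Omega_S.
  + by move=> n; apply: ht; apply: XO; apply: subset_closure; exact: dD.
  + have := @weak_cvg_affine _ _ _ _ lam^-1 w ty; congr (weak_cvg _ _).
    apply/funext => n /=; rewrite /tl /w scalerDr scalerA mulVf// scale1r.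
    by rewrite addrK.
exists x; first exact: XO.
exists (lam^-1 *: x + w) => //.
by rewrite scalerDr scalerA divff// scale1r /w scalerN scalerA divff// scale1r subrK.
Qed.

End Contraction.

Unset Implicit Arguments.

Theorem theorem3p1 (R : realType) (E : completeNormedModType R)
    (S : set E) (T : E -> set E) (Omega : set E) (phi : R -> R)
    (S_neq0 : S !=set0) (S_closed : closed S) (S_convex : convex_set S)
    (T_multimap : multimap_on S T)
    (T_graph : weakly_seq_closed_graph S T)
    (Omega_iter : exists n, Omega = hull_iter S T n)
    (Omega_bounded : bounded_set Omega)
    (T_hemi : hemi_weakly_compact Omega T)
    (T_values : forall x, Omega x -> closed (T x) /\ convex_set (T x))
    (T_Lipschitz : countably_D_set_Lipschitzian Omega T phi)
    (phi_le : forall r, 0 < r -> r <= set_norm Omega -> phi r <= r) :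
  exists2 x, Omega x & T x x.
Proof.
have [Oc Oconv [x0 Ox0] OS TO] : [/\ closed Omega, convex_lmod Omega,
    Omega !=set0, Omega `<=` S & mimage T Omega `<=` Omega].
  have [n ->] := Omega_iter; exact: hull_iterP.
have [M M0 OM] := pinfty_ex_gt0 Omega_bounded.
have T0 x : Omega x -> T x !=set0 by move=> /OS /T_multimap[].
have /choice[x_ hx] : forall n : nat, exists x, Omega x /\
    exists y, T x y /\ `|x - y| <= n.+1%:R^-1 * (M + M).
  move=> n; pose lam : R := 1 - n.+2%:R^-1.
  have ninv : 0 < (n.+2%:R^-1 : R) < 1.
    by rewrite invr_gt0 ltr0n/= invf_lt1 ?ltr1n// ltr0n.
  have lam01 : 0 < lam < 1 by move: ninv; rewrite /lam; set a := n.+2%:R^-1; lra.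
  have [x Ox [y Txy xE]] := contraction_fixed_point T_graph Oc Oconv OS T0 TO M0
    OM T_values T_Lipschitz phi_le Ox0 lam01.
  exists x; split => //; exists y; split => //.
  have Oy : Omega y by apply: TO; exists x.
  have -> : x - y = n.+2%:R^-1 *: (x0 - y).
    rewrite {1}xE /lam subKr scalerBl scale1r scalerBr.
    by rewrite addrAC [y - _]addrC addrK addrC.
  rewrite normrZ gtr0_norm ?invr_gt0// ler_pM ?invr_ge0//.
    by rewrite lef_pV2 ?posrE// ler_nat.
  by rewrite (le_trans (ler_normB _ _))// lerD// OM.
have /choice[y_ hy] := fun n => (hx n).2.
have xy0 : weak_cvg (fun n => x_ n - y_ n) 0.
  apply: (norm_weak_cvg0 (fun n => (hy n).2)).
  rewrite -[X in _ --> X](mul0r (M + M)); apply: cvgMl; exact: cvg_harmonic.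
have [k k_incr [x xk]] := T_hemi x_ y_ (fun n => (hx n).1) (fun n => (hy n).1)
  (ex_intro _ 0 xy0).
have Ox : Omega x.
  apply: (weak_limit_closed (F := fmap (x_ \o k) \oo) Oc Oconv).
    by exists 0%N => // n _; exact: (hx (k n)).1.
  exact/weak_cvg_seqP.
exists x => //; apply: (T_graph (x_ \o k) (y_ \o k)) => //.
- by move=> n; apply: OS; exact: (hx (k n)).1.
- exact: OS.
- by move=> n; exact: (hy (k n)).1.
have yx0 : weak_cvg (fun n => (-1) *: (x_ (k n) - y_ (k n)) + 0) ((-1) *: 0 + 0).
  exact/weak_cvg_affine/(weak_cvg_subseq k_incr xy0).
have := weak_cvgD xk yx0; rewrite !addr0 scaler0 addr0; congr (weak_cvg _ _).
by apply/funext => n /=; rewrite addr0 scaleN1r opprB addrC subrK.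
Qed.
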